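(* Consider the resource allocation problem $$\min_{y\in\mathbb{R}^{Nn}} \sum_{i=1}^N f_i(y_i)\quad\text{subject to}\quad \sum_{i=1}^N y_i=\sum_{i=1}^N d_i,\quad y_i\in\Omega_i,\ i=1,\dots,N, \qquad (P)$$ with $y=\mathrm{col}(y_1,\dots,y_N)$, $d_i\in\mathbb{R}^n$, and each $\Omega_i\subset\mathbb{R}^n$ closed and convex. Suppose Slater's condition holds (there exist $z_i$ in the relative interior of $\Omega_i$, $i=1,\dots,N$, with $\sum_i z_i=\sum_i d_i$), each $f_i$ is convex and locally Lipschitz continuous, and each $f_i$ is strictly convex on $\Omega_i$. Let $y^*$ be the optimal solution of $(P)$. Suppose the communication graph is a connected undirected graph, and let $k_1,k_2,k_3>0$ be arbitrary. Consider the algorithm, for $i=1,\dots,N$, $$\begin{cases}\dot x_i\in y_i-x_i-\partial f_i(y_i)+s_i\\ \dot s_i=k_1(w_i-y_i+d_i)+k_2\sum_{j=1}^N a_{ij}(s_j-s_i)\\ \dot w_i=k_3\sum_{j=1}^N a_{ij}\big((w_j-y_j+d_j)-(w_i-y_i+d_i)\big)\\ y_i=P_{\Omega_i}(x_i).\end{cases}$$ If the initial point satisfies $\sum_{i=1}^N w_i(0)=0_n$, then the algorithm converges asymptotically to the optimal solution of $(P)$: for every solution with such an initial point, $\lim_{t\to\infty}y(t)=y^*$.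
   Context: $N\ge 2$ agents. Each $f_i$ is a (possibly nonsmooth) real-valued function defined on an open convex neighbourhood of $\Omega_i$ (for instance all of $\mathbb{R}^n$), on which it is convex and locally Lipschitz; $\partial f_i$ is the Clarke generalized gradient, which for convex $f_i$ is the convex subdifferential. $f_i$ is strictly convex on $\Omega_i$ if $(p-q)^T(\gamma_p-\gamma_q)>0$ for all $p\ne q$ in $\Omega_i$, $\gamma_p\in\partial f_i(p)$, $\gamma_q\in\partial f_i(q)$. $P_{\Omega}(p)=\arg\min_{q\in\Omega}\|p-q\|$ is the Euclidean projection onto a closed convex set $\Omega$. $\mathrm{col}(\cdot)$ denotes stacking of column vectors and $0_n$ the zero vector of $\mathbb{R}^n$. The communication graph has nodes $1,\dots,N$ and weighted adjacency matrix $\mathcal{A}=(a_{ij})$ with $a_{ij}\ge0$ and $a_{ij}>0$ iff node $i$ can receive information from node $j$; it is undirected when $a_{ij}=a_{ji}$ for all $i,j$. The variables are $x_i,s_i,w_i\in\mathbb{R}^n$, and $y=\mathrm{col}(y_1,\dots,y_N)$. A solution is a Carathéodory solution on $[0,\infty)$: $(x,s,w)$ is (locally) absolutely continuous and satisfies the inclusion and equations for almost every $t$, with $y_i(t)=P_{\Omega_i}(x_i(t))$. *)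

(* Defs.v *)
From HB Require Import structures.
From mathcomp Require Import all_boot all_order all_algebra.
From mathcomp Require Import all_classical all_reals all_analysis.

Set Implicit Arguments.
Unset Strict Implicit.
Unset Printing Implicit Defensive.

Import Order.TTheory GRing.Theory Num.Theory.
Import numFieldNormedType.Exports.

Local Open Scope classical_set_scope.
Local Open Scope ring_scope.

(* Vectors of R^n are rows 'rV[R]_n, and a stacked vector
   col(y_1, ..., y_N) is the family y : 'I_N -> 'rV[R]_n of its blocks. The
   library norm on 'rV[R]_n is the sup norm: it is used below only for notions
   that do not depend on the choice of a norm on R^n (topology, Lipschitz
   continuity, absolute continuity, derivatives). *)

Section Euclidean.
Context {R : realType} {n : nat}.
Implicit Types (u v p q : 'rV[R]_n) (A : set 'rV[R]_n).

Definition dot u v : R := \sum_(k < n) u ord0 k * v ord0 k.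

Definition enorm u : R := Num.sqrt (dot u u).

Definition is_proj A p q : Prop :=
  A q /\ forall z, A z -> enorm (p - q) <= enorm (p - z).

(* The minimizer exists and is unique when A is nonempty, closed and convex;
   otherwise the value may be unspecified. *)
Definition proj A p : 'rV[R]_n := get (is_proj A p).

Definition affine_hull A : set 'rV[R]_n :=
  [set p | exists (m : nat) (c : 'I_m -> R) (q : 'I_m -> 'rV[R]_n),
     [/\ forall k, A (q k), \sum_(k < m) c k = 1
       & p = \sum_(k < m) c k *: q k]].

Definition relint A : set 'rV[R]_n :=
  [set p | A p /\ \forall q \near p, affine_hull A q -> A q].

End Euclidean.

Section Nonsmooth.
Context {R : realType} {n : nat}.
Implicit Types (f : 'rV[R]_n -> R) (U A : set 'rV[R]_n).

Definition locally_lipschitz U f : Prop :=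
  forall p, U p -> lipschitz_on (f : 'rV[R]_n -> R^o) (nbhs (p, p)).

(* f°(p; v) = limsup_{q -> p, t -> 0+} (f (q + t v) - f q) / t *)
Definition clarke_derivative f (p v : 'rV[R]_n) : \bar R :=
  limf_esup
    (fun qt : 'rV[R]_n * R => ((f (qt.1 + qt.2 *: v) - f qt.1) / qt.2)%:E)
    (filter_prod (nbhs p) (0 : R)^'+).

Definition clarke_gradient f (p : 'rV[R]_n) : set 'rV[R]_n :=
  [set g | forall v, ((dot g v)%:E <= clarke_derivative f p v)%E].

Definition strictly_convex_on A f : Prop :=
  forall p q gp gq, A p -> A q -> p <> q ->
    clarke_gradient f p gp -> clarke_gradient f q gq ->
    0 < dot (p - q) (gp - gq).

End Nonsmooth.

Section AbsoluteContinuity.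
Context {R : realType} {V : normedModType R}.

Definition abs_continuous (a b : R) (g : R -> V) : Prop :=
  forall e : R, 0 < e -> exists2 d : R, 0 < d &
    forall (m : nat) (l r : 'I_m -> R),
      (forall k, a <= l k /\ l k <= r k /\ r k <= b) ->
      trivIset setT (fun k => `]l k, r k[%classic) ->
      \sum_(k < m) (r k - l k) < d ->
      \sum_(k < m) `|g (r k) - g (l k)| < e.

Definition locally_abs_continuous (g : R -> V) : Prop :=
  forall b : R, 0 < b -> abs_continuous 0 b g.

End AbsoluteContinuity.

Section ResourceAllocation.
Context {R : realType} {N n : nat}.
Implicit Types (Omega : 'I_N -> set 'rV[R]_n) (d y z : 'I_N -> 'rV[R]_n)
  (f : 'I_N -> 'rV[R]_n -> R) (a : 'M[R]_N).

Definition slater Omega d : Prop :=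
  exists z, (forall i, relint (Omega i) (z i)) /\
    \sum_(i < N) z i = \sum_(i < N) d i.

Definition feasible Omega d y : Prop :=
  \sum_(i < N) y i = \sum_(i < N) d i /\ forall i, Omega i (y i).

Definition optimal f Omega d y : Prop :=
  feasible Omega d y /\
  forall z, feasible Omega d z ->
    \sum_(i < N) f i (y i) <= \sum_(i < N) f i (z i).

Definition undirected_graph a : Prop :=
  (forall i j, 0 <= a i j) /\ (forall i j, a i j = a j i).

Definition connected_graph a : Prop :=
  forall i j : 'I_N, connect [rel i' j' : 'I_N | 0 < a i' j'] i j.

(* Trajectories are functions on R whose values on negative times play no
   role: at t > 0 the two-sided derivative only involves nearby positive times,
   and t = 0 is a null set. *)
Definition solution (k1 k2 k3 : R) a f Omega d
    (x s w y : 'I_N -> R -> 'rV[R]_n) : Prop :=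
  [/\ forall i, locally_abs_continuous (x i),
      forall i, locally_abs_continuous (s i),
      forall i, locally_abs_continuous (w i),
      forall i t, 0 <= t -> y i t = proj (Omega i) (x i t)
    & {ae (@lebesgue_measure R), forall t : R, 0 <= t -> forall i,
        [/\ exists2 g, clarke_gradient (f i) (y i t) g &
              is_derive t 1 (x i) (y i t - x i t - g + s i t),
            is_derive t 1 (s i)
              (k1 *: (w i t - y i t + d i)
               + k2 *: \sum_(j < N) a i j *: (s j t - s i t))
          & is_derive t 1 (w i)
              (k3 *: \sum_(j < N) a i j *:
                 ((w j t - y j t + d j) - (w i t - y i t + d i)))]}].

End ResourceAllocation.

(* Main.v *)
Require Import Defs.
From HB Require Import structures.
From mathcomp Require Import all_boot all_order all_algebra.
From mathcomp Require Import all_classical all_reals all_analysis.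
From mathcomp Require Import measurable_realfun ring lra.

Import Order.TTheory GRing.Theory Num.Theory.
Import numFieldNormedType.Exports.

Local Open Scope classical_set_scope.
Local Open Scope ring_scope.

(** The proof is a Lyapunov argument: along a trajectory a nonnegative function V
decreases, and it would decrease by a fixed amount infinitely often if y did not
converge to ystar.

Optimality of ystar and Slater's condition give a multiplier lam for the
coupling constraint ([multiplier_exists]): each
D_i z = f_i z - f_i (ystar_i) - lam . (z - ystar_i), called [gap] below, is
nonnegative on Omega_i. Strict convexity makes D_i vanish at ystar_i only, and
compactness bounds D_i away from 0 on bounded parts of Omega_i away from
ystar_i ([gap_gt0], [gap_lower_bound]).

Put S_i = s_i - lam, omega_i = w_i - (ystar_i - d_i) and
eta_i = y_i - ystar_i. The Lyapunov function V has two parts.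
- The first part is the sum over i of
  (|x_i - ystar_i|^2 - |x_i - P_i x_i|^2) / 2, with P_i the projection onto
  Omega_i. This function of x_i is differentiable with gradient
  P_i x_i - ystar_i ([proj_energy_smooth]), so along the flow its derivative is
  at most the sum of eta_i . S_i - D_i y_i ([agent_dissipation]).
- The second part is |S|^2 / (2 k1) + |rho|^2 / (2 k1 k2 k3), where
  rho = k3 (S - mean S) + k1 psi and psi solves lap psi = omega. Such a psi
  exists because the graph is connected and the omega_i have sum zero, which is
  where the condition on the initial point enters ([sum_omega]). The
  combination rho is chosen so that its derivative is - k2 k3 lap S, free of eta
  and omega. Its square then produces exactly - S . omega, which cancels the
  term + S . omega coming from |S|^2; hence the derivative of the second part
  is at most - S . eta ([network_decay]).
Together V' <= - sum_i D_i y_i almost everywhere ([lyapunov_ae]).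

An absolutely continuous function whose derivative is nonpositive almost
everywhere is nonincreasing ([ae_derive_le0_nonincreasing]). Hence V decreases,
and it bounds y and s; then the subgradients are bounded, then x, which solves
x' = - x + bounded; so x, and with it y, is Lipschitz in time. Therefore, if y_i
is at distance at least e from ystar_i at some time, D_i stays above a fixed
positive number during a fixed time, and V drops by a fixed amount. As V is
nonincreasing and nonnegative, this stops happening eventually
([dissipation_cvg]), which is the claimed convergence. *)

(** * Euclidean geometry and projections *)

Section EuclideanAlgebra.
Context {R : realType} {n : nat}.
Implicit Types (u v w : 'rV[R]_n).

Lemma dotC u v : dot u v = dot v u.
Proof. by apply: eq_bigr => k _; rewrite mulrC. Qed.

Lemma dotDl u v w : dot (u + v) w = dot u w + dot v w.
Proof. by rewrite -big_split; apply: eq_bigr => k _; rewrite mxE mulrDl. Qed.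

Lemma dotZl c u w : dot (c *: u) w = c * dot u w.
Proof. by rewrite mulr_sumr; apply: eq_bigr => k _; rewrite mxE mulrA. Qed.

Lemma dotNl u w : dot (- u) w = - dot u w.
Proof. by rewrite -scaleN1r dotZl mulN1r. Qed.

Lemma dotBl u v w : dot (u - v) w = dot u w - dot v w.
Proof. by rewrite dotDl dotNl. Qed.

Lemma dotDr u v w : dot w (u + v) = dot w u + dot w v.
Proof. by rewrite dotC dotDl !(dotC w). Qed.

Lemma dotZr c u w : dot w (c *: u) = c * dot w u.
Proof. by rewrite dotC dotZl (dotC w). Qed.

Lemma dotNr u w : dot w (- u) = - dot w u.
Proof. by rewrite dotC dotNl (dotC w). Qed.

Lemma dotBr u v w : dot w (u - v) = dot w u - dot w v.
Proof. by rewrite dotDr dotNr. Qed.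

Lemma dotBB u v : dot (u - v) (u - v) = dot u u - 2 * dot u v + dot v v.
Proof. by rewrite !(dotBl, dotBr) (dotC v); ring. Qed.

Definition dot_linE := (dotDl, dotDr, dotBl, dotBr, dotZl, dotZr, dotNl, dotNr).

Lemma dot_ge0 u : 0 <= dot u u.
Proof. by apply: sumr_ge0 => k _; rewrite -expr2 sqr_ge0. Qed.

Lemma sqr_coord_le_dot u k : u ord0 k ^+ 2 <= dot u u.
Proof.
rewrite /dot (bigD1 k)//= -expr2 lerDl.
by apply: sumr_ge0 => j _; rewrite -expr2 sqr_ge0.
Qed.

Lemma coord_le_norm u k : `|u ord0 k| <= `|u|.
Proof.
rewrite [leRHS]/Num.Def.normr/= mx_normrE.
by apply: (le_trans _ (le_bigmax _ _ (ord0, k))).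
Qed.

Lemma norm_le_coord u (c : R) : 0 <= c -> (forall k, `|u ord0 k| <= c) -> `|u| <= c.
Proof.
move=> c0 uc; rewrite [leLHS]/Num.Def.normr/= mx_normrE.
by apply: bigmax_le => // -[i k] _ /=; rewrite (ord1 i).
Qed.

Lemma norm_lt_dot u (c : R) : 0 < c -> dot u u < c ^+ 2 -> `|u| < c.
Proof.
move=> c0 uc; have [k0|hk] := pselect (exists k, c <= `|u ord0 k|).
  case: k0 => k ck; have := sqr_coord_le_dot u k.
  have : c ^+ 2 <= u ord0 k ^+ 2.
    by rewrite -(real_normK (num_real (u ord0 k))) lerXn2r ?nnegrE// ltW.
  by move=> h1 h2; move: (le_lt_trans (le_trans h1 h2) uc); rewrite ltxx.
have : forall k, `|u ord0 k| < c.
  by move=> k; rewrite ltNge; apply/negP => h; apply: hk; exists k.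
move=> h; rewrite /Num.Def.normr/= mx_normrE.
by apply: bigmax_lt => // -[i k] _ /=; rewrite (ord1 i).
Qed.

Lemma dot_le_norm u v : `|dot u v| <= n%:R * (`|u| * `|v|).
Proof.
rewrite (le_trans (ler_norm_sum _ _ _))//.
have -> : n%:R * (`|u| * `|v|) = \sum_(k < n) `|u| * `|v|.
  by rewrite sumr_const card_ord mulr_natl.
apply: ler_sum => k _.
by rewrite normrM ler_pM// coord_le_norm.
Qed.

Lemma norm_le_dot u (c : R) : 0 <= c -> dot u u <= c ^+ 2 -> `|u| <= c.
Proof.
move=> c0 uc; apply/ler_addgt0Pr => e e0; apply/ltW/norm_lt_dot; first by lra.
by apply: (le_lt_trans uc); rewrite ltrXn2r// ?nnegrE; lra.
Qed.

Lemma enorm_le u v : (enorm u <= enorm v) = (dot u u <= dot v v).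
Proof. by rewrite /enorm ler_sqrt ?dot_ge0. Qed.

End EuclideanAlgebra.

Section Projection.
Context {R : realType} {n : nat}.
Implicit Types (A : set 'rV[R]_n) (p q z : 'rV[R]_n).

Lemma convex_setP (A : set 'rV[R]_n) : convex_set A ->
  forall p q (t : R), 0 <= t <= 1 -> A p -> A q -> A (p + t *: (q - p)).
Proof.
move=> cA p q t /andP[t0 t1] Ap Aq.
have := cA q p (Itv01 t0 t1) (mem_set Aq) (mem_set Ap).
rewrite inE; congr (A _); change (t *: q + (1 - t) *: p = p + t *: (q - p)).
by apply/matrixP => i j; rewrite !mxE; ring.
Qed.

Lemma coordB_continuous q k : continuous (fun z : 'rV[R]_n => (q - z) ord0 k : R).
Proof.
move=> z.
have hz : (fun z0 : 'rV[R]_n => z0 ord0 k) x @[x --> z] --> z ord0 k.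
  exact: (@coord_continuous R 1 n ord0 k z).
rewrite (_ : (fun z : 'rV[R]_n => (q - z) ord0 k : R) =
    (fun z : 'rV[R]_n => q ord0 k - z ord0 k : R)); last first.
  by apply/funext => x /=; rewrite !mxE.
have FF : Filter (nbhs z) := nbhs_filter z.
by apply: (@cvgB _ R^o _ (nbhs z) FF); [exact: cvg_cst|exact: hz].
Qed.

Lemma dot_continuous q : continuous (fun z : 'rV[R]_n => dot (q - z) (q - z) : R).
Proof.
move=> z.
have cadd : continuous (fun x : R^o * R^o => x.1 + x.2) by exact: add_continuous.
have FF : Filter (nbhs z) := nbhs_filter z.
apply: (@cvg_big R^o _ _ _ _ cadd _ (nbhs z)) => k _.
by apply: (@cvgM R^o _ (nbhs z) FF); exact: coordB_continuous.
Qed.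

(** Being stated with [dot], this serves for Euclidean balls although the norm
of the space is the sup norm. *)
Lemma compact_dot_ball A q (c : R) : closed A ->
  compact (A `&` [set z | dot (q - z) (q - z) <= c]).
Proof.
move=> cA; apply: bounded_closed_compact.
  exists (`|q| + (`|c| + 1)); split; first exact: num_real.
  move=> M ltM z [_ /= hz]; apply: le_trans (ltW ltM).
  have c0 := normr_ge0 c; have cc := ler_norm c.
  rewrite -[z](subKr q) (le_trans (ler_normB _ _))// lerD2l.
  apply: norm_le_dot; first by lra.
  by rewrite (le_trans hz)// expr2; nra.
apply: closedI => //.
apply: (@preimage_closed _ _ (fun z => dot (q - z) (q - z)) [set x | x <= c]).
  by move=> x _; exact: dot_continuous.
exact: closed_le.
Qed.

Lemma proj_spec A p : closed A -> A !=set0 -> is_proj A p (Defs.proj A p).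
Proof.
move=> cA [z0 Az0]; apply: getPex.
pose B := A `&` [set z | dot (p - z) (p - z) <= dot (p - z0) (p - z0)].
have cB : compact B by exact: compact_dot_ball.
have B0 : B !=set0 by exists z0; split => /=.
have cB' : {within B, continuous (fun z => dot (p - z) (p - z) : R)}.
  by apply: continuous_subspaceT => z; exact: dot_continuous.
have [c Bc minc] := EVT_min_rV B0 cB cB'.
rewrite inE in Bc; exists c; split; first by case: Bc.
move=> z Az; rewrite enorm_le.
have [h|h] := leP (dot (p - z) (p - z)) (dot (p - z0) (p - z0)).
  by apply: minc; rewrite inE.
by apply: le_trans (ltW h); case: Bc.
Qed.

Section OneSet.
Context (A : set 'rV[R]_n).
Hypotheses (clA : closed A) (cvA : convex_set A) (A0 : A !=set0).

Lemma proj_mem p : A (Defs.proj A p).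
Proof. by case: (proj_spec _ p clA A0). Qed.

Lemma proj_variational p z : A z -> dot (p - Defs.proj A p) (z - Defs.proj A p) <= 0.
Proof.
move=> Az; have [Aq hq] := proj_spec _ p clA A0; set q := Defs.proj A p in Aq hq *.
rewrite leNgt; apply/negP => h0.
set c := dot _ _ in h0; set e := dot (z - q) (z - q).
have e0 : 0 <= e by exact: dot_ge0.
(* a positive step that is at most 1 and satisfies t * e <= c, so that the
   quadratic term of the squared distance stays below the linear one *)
pose t := c / (c + e).
have ce : 0 < c + e by lra.
have t01 : 0 <= t <= 1.
  by rewrite divr_ge0 ?(ltW h0) ?(ltW ce)//= /t ler_pdivrMr// mul1r lerDl.
have := hq _ (convex_setP _ cvA _ _ _ t01 Aq Az).
rewrite enorm_le leNgt => /negP; apply.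
have -> : p - (q + t *: (z - q)) = (p - q) - t *: (z - q).
  by rewrite opprD addrA.
have -> : dot (p - q - t *: (z - q)) (p - q - t *: (z - q)) =
    dot (p - q) (p - q) + (- 2 * t * c + t ^+ 2 * e).
  rewrite /c /e; move: (p - q) (z - q) => u v.
  by rewrite !dot_linE (dotC v); ring.
suff : - 2 * t * c + t ^+ 2 * e < 0 by lra.
have -> : - 2 * t * c + t ^+ 2 * e = - t * (2 * c - t * e) by ring.
have t0 : 0 < t by rewrite divr_gt0.
have : t * e <= c.
  rewrite /t mulrAC ler_pdivrMr//; nra.
nra.
Qed.

(** Add the variational inequalities at p and q, each tested against the other
projection. *)
Lemma proj_firm p q :
  dot (Defs.proj A p - Defs.proj A q) (Defs.proj A p - Defs.proj A q)
    <= dot (Defs.proj A p - Defs.proj A q) (p - q).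
Proof.
have := proj_variational p _ (proj_mem q).
have := proj_variational q _ (proj_mem p).
by rewrite !dot_linE; set P := Defs.proj A p; set Q := Defs.proj A q;
  rewrite (dotC p) (dotC q) (dotC p) (dotC q) (dotC Q P); lra.
Qed.

Lemma proj_nonexpansive p q :
  dot (Defs.proj A p - Defs.proj A q) (Defs.proj A p - Defs.proj A q) <= dot (p - q) (p - q).
Proof.
have := dot_ge0 ((p - q) - (Defs.proj A p - Defs.proj A q)).
by rewrite (dotBB (p - q)) (dotC (p - q)); have := proj_firm p q; lra.
Qed.

(** For A closed and convex, this is a convex function of p with gradient
proj p - ystar: the energy of a state that acts through its projection only. *)
Definition proj_energy ystar p : R :=
  (dot (p - ystar) (p - ystar) - dot (p - Defs.proj A p) (p - Defs.proj A p)) / 2.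

(** Replacing the projection of q by that of p can only increase
|q - proj q|^2; what remains is an identity between quadratic forms. *)
Lemma proj_energy_subgradient ystar p q :
  dot (Defs.proj A p - ystar) (q - p) <= proj_energy ystar q - proj_energy ystar p.
Proof.
have [_ /(_ _ (proj_mem p))] := proj_spec _ q clA A0; rewrite enorm_le /proj_energy.
set P := Defs.proj A p; set Q := Defs.proj A q; rewrite !dot_linE.
by rewrite ?(dotC P) ?(dotC Q) ?(dotC ystar) ?(dotC q p); lra.
Qed.

(** The lower bound is the subgradient inequality at p. The upper bound is the
subgradient inequality at q, whose slope differs from the slope at p by
proj q - proj p, and firm nonexpansiveness bounds this difference. A quadratic
error is what makes the energy differentiable although the projection is not. *)
Lemma proj_energy_smooth ystar p q :
  `|proj_energy ystar q - proj_energy ystar p - dot (Defs.proj A p - ystar) (q - p)|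
    <= dot (q - p) (q - p).
Proof.
rewrite ger0_norm ?subr_ge0 ?proj_energy_subgradient//.
have h2 := proj_energy_subgradient ystar q p.
have h3 : dot (Defs.proj A q - Defs.proj A p) (q - p) <= dot (q - p) (q - p).
  have := dot_ge0 ((q - p) - (Defs.proj A q - Defs.proj A p)).
  have := proj_firm q p; rewrite (dotBB (q - p)) (dotC (q - p)).
  move: (dot (_ - _) _) (dot (q - p) (q - p)) (dot (_ - _) _) => a b c; lra.
rewrite lerBlDr; apply: le_trans (lerD h3 (lexx _)).
rewrite -dotDl addrA subrK -[leRHS]opprK -dotNr opprB -[leLHS]opprB lerN2.
exact: h2.
Qed.

(** With P the projection of p, expanding |p - ystar|^2 around P leaves
|P - ystar|^2 and a cross term that the variational inequality makes
nonnegative. *)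
Lemma proj_energy_ge ystar p : A ystar ->
  dot (Defs.proj A p - ystar) (Defs.proj A p - ystar) / 2 <= proj_energy ystar p.
Proof.
move=> /(proj_variational p); rewrite /proj_energy; set P := Defs.proj A p.
by rewrite !dot_linE (dotC p ystar) (dotC p P) (dotC ystar P); lra.
Qed.

End OneSet.
End Projection.

(** * Separation *)

Section Separation.
Context {R : realType}.

(** A slope mu works if it lies between q / b for the points with b < 0 and
r / a for the points with a > 0. These two families are in order because a
segment joining two such points crosses the axis at nonnegative height, and the
last hypothesis provides a point on the other side as soon as there is one
off the axis. *)
Lemma separation_line (C : R -> R -> Prop) :
  (forall a r b q t, 0 <= t <= 1 -> C a r -> C b q ->
     C (a + t * (b - a)) (r + t * (q - r))) ->
  (forall r, C 0 r -> 0 <= r) ->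
  (forall a r, C a r -> exists e q, 0 < e /\ C (- e * a) q) ->
  exists mu, forall a r, C a r -> mu * a <= r.
Proof.
move=> cC C0 coreC.
have cross a r b q : 0 < a -> b < 0 -> C a r -> C b q -> q / b <= r / a.
  move=> a0 b0 Car Cbq; have ab : 0 < a - b by lra.
  pose t := a / (a - b).
  have t01 : 0 <= t <= 1.
    by rewrite divr_ge0 ?(ltW a0) ?(ltW ab)//= /t ler_pdivrMr//; lra.
  have := cC _ _ _ _ _ t01 Car Cbq.
  have -> : a + t * (b - a) = 0 by rewrite /t; field; rewrite gt_eqF.
  move=> /C0; have -> : r + t * (q - r) = (a * q - b * r) / (a - b).
    by rewrite /t; field; rewrite gt_eqF.
  rewrite pmulr_lge0 ?invr_gt0// => h.
  rewrite ler_pdivlMr// mulrAC ler_ndivrMr//; lra.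
pose E := [set x | exists a r, [/\ 0 < a, C a r & x = r / a]].
have [E0|nE0] := pselect (E !=set0); last first.
  exists 0 => a r Car; rewrite mul0r; have [a0|a0|a0] := ltgtP a 0.
  - exfalso; have [e [q [e0 Cq]]] := coreC _ _ Car; apply: nE0.
    by exists (q / (- e * a)), (- e * a), q; split => //; nra.
  - by exfalso; apply: nE0; exists (r / a), a, r.
  - by apply: C0; rewrite -a0.
have lbE b q : b < 0 -> C b q -> lbound E (q / b).
  by move=> b0 Cbq _ [a [r [a0 Car ->]]]; exact: cross.
have hE : has_inf E.
  split => //; have [_ [a [r [a0 Car _]]]] := E0.
  have [e [q [e0 Cq]]] := coreC _ _ Car.
  by exists (q / (- e * a)); apply: lbE => //; nra.
exists (inf E) => a r Car; have [a0|a0|a0] := ltgtP a 0.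
- rewrite -ler_ndivrMr//; apply: lb_le_inf => //; exact: lbE.
- rewrite -ler_pdivlMr//; apply: ge_inf; first by case: hE.
  by exists a, r.
- by rewrite a0 mulr0; apply: C0; rewrite -a0.
Qed.

Lemma dot_row_mx n (a b : R) (u v : 'rV[R]_n) :
  dot (row_mx a%:M u : 'rV_(1 + n)) (row_mx b%:M v) = a * b + dot u v.
Proof.
rewrite /dot big_split_ord/= big_ord1 !row_mxEl !mxE eqxx !mulr1n.
by congr (_ + _); apply: eq_bigr => k _; rewrite !row_mxEr.
Qed.

(** An algebraic form of the Hahn-Banach theorem: C plays the role of the
epigraph of a convex function that is nonnegative at 0, and the last hypothesis
says that 0 is in the relative algebraic interior of its domain. By induction on
the dimension, the hyperplane where the first coordinate vanishes yields the
other coordinates of lam; subtracting their contribution leaves a problem on the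
line. *)
Lemma separation n (C : 'rV[R]_n -> R -> Prop) :
  (forall u r v q t, 0 <= t <= 1 -> C u r -> C v q ->
     C (u + t *: (v - u)) (r + t * (q - r))) ->
  (forall r, C 0 r -> 0 <= r) ->
  (forall u r, C u r -> exists e q, 0 < e /\ C (- e *: u) q) ->
  exists lam, forall u r, C u r -> dot lam u <= r.
Proof.
elim: n C => [|n IHn] C cC C0 coreC.
  exists 0 => u r; rewrite (thinmx0 u) => /C0.
  by rewrite /dot big_ord0.
have rowM (a b : R) (u v : 'rV[R]_n) t :
    row_mx a%:M u + t *: (row_mx b%:M v - row_mx a%:M u) =
    row_mx (a + t * (b - a))%:M (u + t *: (v - u)) :> 'rV_(1 + n).
  rewrite opp_row_mx add_row_mx scale_row_mx add_row_mx; congr row_mx.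
  by apply/matrixP => i j; rewrite !mxE !ord1 eqxx !mulr1n.
have rowZ (c a : R) (u : 'rV[R]_n) :
    c *: row_mx a%:M u = row_mx (c * a)%:M (c *: u) :> 'rV_(1 + n).
  by rewrite scale_row_mx scale_scalar_mx.
have rowE (u : 'rV[R]_(1 + n)) : u = row_mx (u ord0 ord0)%:M (rsubmx u).
  rewrite -{1}(hsubmxK u); congr row_mx; rewrite [LHS]mx11_scalar !mxE.
  by congr (u _ _)%:M; apply/val_inj.
have row0 : row_mx 0%:M 0 = 0 :> 'rV[R]_(1 + n) by rewrite raddf0 row_mx0.
have [||| lam hlam] := IHn (fun v r => C (row_mx 0%:M v : 'rV_(1 + n)) r).
- move=> u r v q t t01 Cu Cv; have := cC _ _ _ _ _ t01 Cu Cv.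
  by rewrite rowM subr0 mulr0 addr0.
- by move=> r; rewrite row0; exact: C0.
- move=> u r /coreC[e [q [e0 Cq]]]; exists e, q; split => //.
  by move: Cq; rewrite rowZ mulr0.
have [||| mu hmu] := separation_line (fun a r => exists v q,
  C (row_mx a%:M v : 'rV_(1 + n)) q /\ r = q - dot lam v).
- move=> a _ b _ t t01 [u [r [Cu ->]]] [v [q [Cv ->]]].
  exists (u + t *: (v - u)), (r + t * (q - r)); split; last first.
    by rewrite !dot_linE; ring.
  by rewrite -rowM; exact: cC.
- by move=> _ [v [q [Cv ->]]]; rewrite subr_ge0; exact: hlam.
- move=> a _ [v [q [/coreC[e [r [e0 Cr]]] _]]].
  exists e, (r - dot lam (- e *: v)); split => //.
  by exists (- e *: v), r; split => //; rewrite -rowZ.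
exists (row_mx mu%:M lam : 'rV_(1 + n)) => u r.
rewrite (rowE u) dot_row_mx => Cu; rewrite -lerBrDr.
by apply: hmu; exists (rsubmx (u : 'rV_(1 + n))), r.
Qed.

End Separation.

(** * Convex functions and Clarke gradients *)

Section NormNeighborhoods.
Context {R : realType} {n : nat}.
Implicit Types (p q u : 'rV[R]_n) (A : set 'rV[R]_n).

Lemma nbhs_rowP p A :
  nbhs p A <-> exists2 e : R, 0 < e & forall q, `|q - p| < e -> A q.
Proof.
split=> [/nbhs_ballP[e /= e0 eA]|[e e0 eA]].
  by exists e => // q qp; apply: eA; rewrite -ball_normE /ball_/= distrC.
apply/nbhs_ballP; exists e => //= q; rewrite -ball_normE /ball_/= distrC.
exact: eA.
Qed.

Lemma nbhs_right_step p u A : nbhs p A -> \forall t \near 0^'+, A (p + t *: u).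
Proof.
move=> /nbhs_rowP[e e0 eA]; near=> t; apply: eA.
have t0 : 0 < t by near: t; exact: nbhs_right_gt.
rewrite addrAC subrr add0r normrZ (gtr0_norm t0).
have : t <= e / (`|u| + 1).
  by near: t; apply: nbhs_right_le; rewrite divr_gt0// ltr_wpDl.
by rewrite ler_pdivlMr ?ltr_wpDl//; nra.
Unshelve. all: by end_near. Qed.

End NormNeighborhoods.

Section ConvexSubgradients.
Context {R : realType} {n : nat}.
Implicit Types (f : 'rV[R]_n -> R) (U A : set 'rV[R]_n) (p q g v : 'rV[R]_n).

Definition subgradient U f p g : Prop :=
  forall q, U q -> dot g (q - p) <= f q - f p.

Lemma convex_functionP U f : convex_function U f ->
  forall p q (t : R), 0 <= t <= 1 -> U p -> U q ->
  f (p + t *: (q - p)) <= f p + t * (f q - f p).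
Proof.
move=> cf p q t /andP[t0 t1] Up Uq.
have := cf (Itv01 t0 t1) q p (mem_set Uq) (mem_set Up).
change (f (t *: q + (1 - t) *: p) <= t * f q + (1 - t) * f p ->
  f (p + t *: (q - p)) <= f p + t * (f q - f p)).
have -> : t *: q + (1 - t) *: p = p + t *: (q - p).
  by apply/matrixP => i j; rewrite !mxE; ring.
by move=> h; apply: (le_trans h); rewrite le_eqVlt; apply/orP; left; apply/eqP; ring.
Qed.

Lemma locally_lipschitzP U f p : locally_lipschitz U f -> U p ->
  exists M e : R, [/\ 0 < M, 0 < e & forall q1 q2,
    `|q1 - p| < e -> `|q2 - p| < e -> `|f q1 - f q2| <= M * `|q1 - q2|].
Proof.
move=> lf Up; have [M [_ hM]] := lf p Up.
have M1 : M < `|M| + 1 by rewrite (le_lt_trans (ler_norm M))// ltrDl.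
have /= := hM _ M1; rewrite /dominated_by/=.
move=> -[[A B]/= [/nbhs_rowP[a a0 aA] /nbhs_rowP[b b0 bB]] AB].
exists (`|M| + 1), (Num.min a b); split; first by rewrite ltr_wpDl.
  by rewrite lt_min a0.
move=> q1 q2; rewrite !lt_min => /andP[q1a _] /andP[_ q2b].
exact: (AB (q1, q2) (conj (aA _ q1a) (bB _ q2b))).
Qed.

Lemma locally_lipschitz_continuous U f p : locally_lipschitz U f -> U p ->
  f q @[q --> p] --> f p.
Proof.
move=> lf Up; have [M [e [M0 e0 hM]]] := locally_lipschitzP _ _ _ lf Up.
have FF : Filter (nbhs p) := nbhs_filter p.
apply/(@cvgrPdist_le _ R^o) => /= d d0; apply/nbhs_rowP.
exists (Num.min e (d / M)); first by rewrite lt_min e0 divr_gt0.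
move=> q; rewrite lt_min => /andP[qe qd].
apply: le_trans (hM _ _ _ qe) _; first by rewrite subrr normr0.
by rewrite distrC mulrC -ler_pdivlMr// ltW.
Qed.

Section OneFunction.
Context (U : set 'rV[R]_n) (f : 'rV[R]_n -> R).
Hypotheses (oU : open U) (cU : convex_set U) (cf : convex_function U f)
  (lf : locally_lipschitz U f).

Lemma open_near p : U p -> nbhs p U.
Proof. by move=> Up; exact: open_nbhs_nbhs. Qed.

(** Separate the translated epigraph of f at p; U being open provides points of
U on the opposite side of p. *)
Lemma subgradient_exists p : U p -> exists g, subgradient U f p g.
Proof.
move=> Up.
have [||| g hg] := separation n (fun u r => U (p + u) /\ f (p + u) - f p <= r).
- move=> u r v q t t01 [Uu hu] [Uv hv].
  have -> : p + (u + t *: (v - u)) = (p + u) + t *: ((p + v) - (p + u)).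
    by apply/matrixP => i j; rewrite !mxE; ring.
  split; first exact: convex_setP.
  have := convex_functionP _ _ cf _ _ _ t01 Uu Uv.
  by case/andP: t01 => t0 t1; nra.
- by move=> r [_]; rewrite addr0 subrr.
- move=> u r _; near (0 : R)^'+ => t.
  exists t, (f (p + - t *: u) - f p); split; first by near: t; exact: nbhs_right_gt.
  split => //; rewrite scaleNr -scalerN; near: t.
  by apply: nbhs_right_step; exact: open_near.
exists g => q Uq; apply: hg; by rewrite addrC subrK.
Unshelve. all: by end_near. Qed.

(** In the limit superior that defines the Clarke derivative one may freeze the
base point at p and let only the step tend to 0. *)
Lemma subgradient_clarke p g : U p -> subgradient U f p g -> clarke_gradient f p g.
Proof.
move=> Up hg v; apply: le_ereal_inf_tmp => _ [V [[A B]/= [pA B0] ABV] <-].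
near (0 : R)^'+ => t.
have t0 : 0 < t by near: t; exact: nbhs_right_gt.
have Vt : V (p, t).
  by apply: ABV; split => /=; [exact: nbhs_singleton|near: t].
apply: (@le_trans _ _ ((f (p + t *: v) - f p) / t)%:E); last first.
  by apply: ereal_sup_ubound; exists (p, t).
rewrite lee_fin ler_pdivlMr// mulrC -dotZr.
rewrite [X in dot _ X](_ : _ = p + t *: v - p); last by rewrite addrAC subrr add0r.
apply: hg; near: t; by apply: nbhs_right_step; exact: open_near.
Unshelve. all: by end_near. Qed.

(** By convexity a difference quotient with a step at most 1 is bounded by the
one with step 1, namely f (x + (q - p)) - f x, which tends to f q - f p as x
tends to p. *)
Lemma clarke_subgradient p g : U p -> clarke_gradient f p g -> subgradient U f p g.
Proof.
move=> Up hg q Uq; apply/ler_addgt0Pr => e e0.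
rewrite -lee_fin; apply: le_trans (hg (q - p)) _.
pose V := [set xt : 'rV[R]_n * R | [/\ U xt.1, U (xt.1 + (q - p)), 0 < xt.2 <= 1 &
  f (xt.1 + (q - p)) - f xt.1 <= f q - f p + e]].
apply: (@le_trans _ _ (ereal_sup ((fun xt : 'rV[R]_n * R =>
    ((f (xt.1 + xt.2 *: (q - p)) - f xt.1) / xt.2)%:E) @` V))).
  apply: ereal_inf_lbound; exists V => //.
  have cfp := locally_lipschitz_continuous _ _ _ lf Up.
  have cfq := locally_lipschitz_continuous _ _ _ lf Uq.
  have e2 : 0 < e / 2 by lra.
  have Fp : Filter (nbhs p) := nbhs_filter p.
  have Fq : Filter (nbhs q) := nbhs_filter q.
  move/(@cvgrPdist_le _ R^o) : cfp => /(_ _ e2)/nbhs_rowP[a a0 ha].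
  move/(@cvgrPdist_le _ R^o) : cfq => /(_ _ e2)/nbhs_rowP[b b0 hb].
  have /nbhs_rowP[c c0 hc] := open_near _ Up.
  have /nbhs_rowP[d d0 hd] := open_near _ Uq.
  exists ([set x | `|x - p| < Num.min (Num.min a b) (Num.min c d)], [set t | 0 < t <= 1]).
    split => /=; last first.
      near=> t; apply/andP; split; near: t; [exact: nbhs_right_gt|exact: nbhs_right_le].
    apply/nbhs_rowP; exists (Num.min (Num.min a b) (Num.min c d)) => //.
    by rewrite !lt_min a0 b0 c0.
  move=> [x t]/= [] /=; rewrite !lt_min => /andP[/andP[xa xb] /andP[xc xd]] t01.
  have xq : x + (q - p) - q = x - p.
    by apply/matrixP => i j; rewrite !mxE; ring.
  split => //=; [exact: hc|by apply: hd; rewrite xq|].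
  have := ha _ xa; have := hb (x + (q - p)); rewrite xq => /(_ xb).
  by rewrite !ler_norml => /andP[? ?] /andP[? ?]; lra.
apply: ge_ereal_sup => _ [[x t]/= [/= Ux Uxv /andP[t0 t1] hx] <-].
rewrite lee_fin ler_pdivrMr//.
have := convex_functionP _ _ cf _ _ t _ Ux Uxv.
rewrite (ltW t0) t1 => /(_ isT); rewrite (addrAC x) subrr add0r => h.
nra.
Unshelve. all: by end_near. Qed.

(** A Lipschitz constant of f near p bounds every subgradient there: test the
subgradient inequality on small steps along the coordinate axes. *)
Lemma clarke_near_bounded p : U p ->
  exists M e : R, [/\ 0 < M, 0 < e & forall q g, `|q - p| < e ->
    clarke_gradient f q g -> `|g| <= M].
Proof.
move=> Up; have [M [e [M0 e0 hM]]] := locally_lipschitzP _ _ _ lf Up.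
have /nbhs_rowP[c c0 hc] := open_near _ Up.
exists M, (Num.min (e / 2) (c / 2)); split => //; first by rewrite lt_min !divr_gt0.
move=> q g; rewrite lt_min => /andP[qe qc] hg.
apply: norm_le_coord => [|k]; first exact: ltW.
pose t := Num.min (e / 2) (c / 2).
have t0 : 0 < t by rewrite lt_min !divr_gt0.
have [te tc] : t <= e / 2 /\ t <= c / 2 by rewrite /t !ge_min !lexx orbT.
have dk (b : R) : `|b| = 1 -> b * g ord0 k <= M.
  move=> b1; pose v : 'rV[R]_n := (t * b) *: delta_mx ord0 k.
  have nv : `|v| <= t.
    apply: norm_le_coord => [|j]; first exact: ltW.
    rewrite !mxE eqxx/= normrM normrM b1 mulr1 (gtr0_norm t0).
    by case: (j == k); rewrite ?normr1 ?normr0 ?mulr1 ?mulr0// ltW.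
  have qv : `|q + v - p| <= `|q - p| + `|v| by rewrite addrAC ler_normD.
  have Uq : U q by apply: hc; lra.
  have := clarke_subgradient _ _ Uq hg (q + v).
  have Uqv : U (q + v) by apply: hc; lra.
  move=> /(_ Uqv); rewrite (addrAC q) subrr add0r => h1.
  have : `|f (q + v) - f q| <= M * `|q + v - q| by apply: hM; lra.
  rewrite (addrAC q) subrr add0r => h2.
  have : dot g v = t * (b * g ord0 k).
    rewrite /dot (bigD1 k)//= big1 ?addr0; last first.
      by move=> j jk; rewrite !mxE (negbTE jk) andbF !mulr0.
    by rewrite !mxE !eqxx/=; ring.
  move=> dg; rewrite -(ler_pM2l t0) -dg (le_trans h1)//.
  rewrite (le_trans (ler_norm _))// (le_trans h2)// mulrC ler_pM2r//.
rewrite ler_norml; have := dk 1 (normr1 _); have := dk (-1); rewrite normrN1.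
by move=> /(_ erefl) h1 h2; lra.
Qed.

End OneFunction.
End ConvexSubgradients.

(** * Multipliers and the optimality gap *)

Section OptimalityGap.
Context {R : realType} {n : nat}.
Implicit Types (p q g z : 'rV[R]_n).

Lemma dotr_continuous g q : continuous (fun z : 'rV[R]_n => dot g (z - q) : R).
Proof.
move=> z.
have cadd : continuous (fun x : R^o * R^o => x.1 + x.2) by exact: add_continuous.
have FF : Filter (nbhs z) := nbhs_filter z.
apply: (@cvg_big R^o _ _ _ _ cadd _ (nbhs z)) => k _.
apply: (@cvgM R^o _ (nbhs z) FF); first exact: cvg_cst.
rewrite -opprB; have -> : (fun x : 'rV[R]_n => (x - q) ord0 k) = (fun x => - (q - x) ord0 k).
  by apply/funext => x; rewrite !mxE opprB.
by rewrite mxE; apply: (@cvgN _ R^o _ (nbhs z) FF); exact: coordB_continuous.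
Qed.

(** The Lagrangian of one agent relative to its value at q. The multiplier lam
is characterized by the nonnegativity of the gaps of all the agents. *)
Definition gap (f : 'rV[R]_n -> R) (lam q z : 'rV[R]_n) : R :=
  f z - f q - dot lam (z - q).

Section OneAgent.
Context (U Omega : set 'rV[R]_n) (f : 'rV[R]_n -> R) (lam q : 'rV[R]_n).
Hypotheses (oU : open U) (cU : convex_set U) (cf : convex_function U f)
  (lf : locally_lipschitz U f).
Hypotheses (clO : closed Omega) (cO : convex_set Omega) (OU : Omega `<=` U)
  (sO : strictly_convex_on Omega f) (Oq : Omega q).
Hypothesis gap_ge0 : forall z, Omega z -> 0 <= gap f lam q z.

(** If the gap vanished at z, then, being convex and nonnegative, it would vanish
on the whole segment from q to z. Subgradients of f at two inner points of the
segment then have the same slope along it, against strict monotonicity. *)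
Lemma gap_gt0 z : Omega z -> z <> q -> 0 < gap f lam q z.
Proof.
move=> Oz zq; rewrite lt_neqAle gap_ge0// andbT; apply/eqP => gz0.
have fz : f z - f q = dot lam (z - q) by move: gz0; rewrite /gap; lra.
have fseg (t : R) : 0 <= t <= 1 -> Omega (q + t *: (z - q)) /\
    f (q + t *: (z - q)) = f q + t * dot lam (z - q).
  move=> t01; have Ot := convex_setP _ cO _ _ _ t01 Oq Oz; split => //.
  apply/eqP; rewrite eq_le; apply/andP; split.
    by rewrite -fz; exact: (convex_functionP _ _ cf _ _ _ t01 (OU _ Oq) (OU _ Oz)).
  by have := gap_ge0 _ Ot; rewrite /gap (addrAC q) subrr add0r dotZr; lra.
(* q and z lie on both sides of the point, hence the two inequalities *)
have slope (t : R) g : 0 < t < 1 -> subgradient U f (q + t *: (z - q)) g ->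
    dot g (z - q) = dot lam (z - q).
  move=> /andP[t0 t1] hg; have [|_ ft] := fseg t; first by lra.
  have h1 := hg _ (OU _ Oq); have h2 := hg _ (OU _ Oz).
  have e1 : q - (q + t *: (z - q)) = - t *: (z - q).
    by apply/matrixP => i j; rewrite !mxE; ring.
  have e2 : z - (q + t *: (z - q)) = (1 - t) *: (z - q).
    by apply/matrixP => i j; rewrite !mxE; ring.
  rewrite e1 dotZr ft in h1; rewrite e2 dotZr ft in h2.
  move: h1 h2 fz; set a := dot g (z - q); set b := dot lam (z - q) => h1 h2 fz'.
  have h2' : (1 - t) * a <= (1 - t) * b by lra.
  have h1' : t * b <= t * a by lra.
  apply/eqP; rewrite eq_le; apply/andP; split.
    by move: h2'; rewrite ler_pM2l//; lra.
  by move: h1'; rewrite ler_pM2l.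
have t13 : 0 < (3^-1 : R) < 1 by lra.
have t23 : 0 < (2 / 3 : R) < 1 by lra.
have [|O1 _] := fseg 3^-1; first by lra.
have [|O2 _] := fseg (2 / 3); first by lra.
have [g1 hg1] := subgradient_exists _ _ oU cU cf _ (OU _ O1).
have [g2 hg2] := subgradient_exists _ _ oU cU cf _ (OU _ O2).
have e12 : (q + 2 / 3 *: (z - q)) - (q + 3^-1 *: (z - q)) = 3^-1 *: (z - q).
  by apply/matrixP => i j; rewrite !mxE; field.
have p12 : q + 2 / 3 *: (z - q) <> q + 3^-1 *: (z - q).
  move=> e; move: e12; rewrite e subrr => /esym/eqP.
  by rewrite scaler_eq0 invr_eq0 pnatr_eq0/= subr_eq0 => /eqP.
have := sO _ _ _ _ O2 O1 p12 (subgradient_clarke _ _ oU _ _ (OU _ O2) hg2)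
  (subgradient_clarke _ _ oU _ _ (OU _ O1) hg1).
rewrite e12 dotZl dotBr !(dotC (z - q)) (slope _ _ t23 hg2) (slope _ _ t13 hg1).
by rewrite subrr mulr0 ltxx.
Qed.

Lemma gap_lower_bound (c e : R) : 0 < e -> exists2 del : R, 0 < del &
  forall z, Omega z -> dot (z - q) (z - q) <= c -> e <= dot (z - q) (z - q) ->
    del <= gap f lam q z.
Proof.
move=> e0; pose A := Omega `&` [set z | e <= dot (q - z) (q - z)].
have clA : closed A.
  apply: closedI => //.
  apply: (@preimage_closed _ _ (fun z => dot (q - z) (q - z)) [set x | e <= x]).
    by move=> x _; exact: dot_continuous.
  exact: closed_ge.
pose K := A `&` [set z | dot (q - z) (q - z) <= c].
have cK : compact K by exact: compact_dot_ball.
have dE z : dot (z - q) (z - q) = dot (q - z) (q - z).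
  by rewrite -opprB dotNl dotNr opprK.
have [K0|nK] := pselect (K !=set0); last first.
  exists 1 => // z Oz zc ze; exfalso; apply: nK; exists z.
  by rewrite dE in zc ze; split => //; split.
have contK : {within K, continuous (gap f lam q)}.
  apply: continuous_in_subspaceT => z; rewrite inE => -[[Oz _] _].
  have FF : Filter (nbhs z) := nbhs_filter z.
  apply: (@cvgB _ R^o _ (nbhs z) FF); last exact: dotr_continuous.
  apply: (@cvgB _ R^o _ (nbhs z) FF); last exact: cvg_cst.
  exact: (locally_lipschitz_continuous _ _ _ lf (OU _ Oz)).
have [z Kz zmin] := EVT_min_rV K0 cK contK.
exists (gap f lam q z).
  rewrite inE in Kz; case: Kz => -[Oz /= ze] _; apply: gap_gt0 => // zq.
  by move: ze; rewrite zq subrr /dot big1 ?leNgt ?e0// => k _; rewrite mxE mul0r.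
move=> y Oy yc ye; apply: zmin; rewrite inE; rewrite dE in yc ye.
by split => //; split.
Qed.

(** The local bounds become uniform on a compact set. *)
Lemma clarke_bounded (c : R) : exists2 M : R, 0 < M &
  forall z g, Omega z -> dot (z - q) (z - q) <= c -> clarke_gradient f z g -> `|g| <= M.
Proof.
have /compact_near_coveringP cov : compact (Omega `&` [set z | dot (q - z) (q - z) <= c]).
  exact: compact_dot_ball.
have h : forall x : 'rV[R]_n, (Omega `&` [set z | dot (q - z) (q - z) <= c]) x ->
    \forall x' \near x & M \near +oo, forall g, clarke_gradient f x' g -> `|g| <= M.
  move=> x [Ox _]; have [M [e [M0 e0 hM]]] := clarke_near_bounded _ _ oU cf lf _ (OU _ Ox).
  have xe : nbhs x [set z | `|z - x| < e] by apply/nbhs_rowP; exists e.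
  exists ([set z | `|z - x| < e], [set M' | M <= M']).
    split; last by apply: nbhs_pinfty_ge; exact: num_real.
    exact: xe.
  by move=> [z M'] /= [ze MM'] g hg; exact: le_trans (hM _ _ ze hg) MM'.
have Finf : Filter (pinfty_nbhs R) by exact _.
have hM := cov R (pinfty_nbhs R) (fun M z => forall g, clarke_gradient f z g -> `|g| <= M) Finf h.
near (pinfty_nbhs R) => M; exists M.
  by near: M; apply: nbhs_pinfty_gt; exact: num_real.
have KM : Omega `&` [set z | dot (q - z) (q - z) <= c] `<=`
  (fun z => forall g, clarke_gradient f z g -> `|g| <= M) by near: M.
move=> z g Oz zc; apply: KM; split => //=.
by rewrite -opprB dotNl dotNr opprK.
Unshelve. all: by end_near. Qed.

End OneAgent.
End OptimalityGap.

Section Multiplier.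
Context {R : realType} {N n : nat}.

(** Continuing from z i slightly beyond the relative interior point z0 i does
not leave Omega i, and finitely many agents have a common step. *)
Lemma slater_step (Omega : 'I_N -> set 'rV[R]_n) (z0 z : 'I_N -> 'rV[R]_n) :
  (forall i, relint (Omega i) (z0 i)) -> (forall i, Omega i (z i)) ->
  exists2 e : R, 0 < e & forall i, Omega i (z0 i + e *: (z0 i - z i)).
Proof.
move=> hz0 hz.
have : \forall e \near (0 : R)^'+, forall i, Omega i (z0 i + e *: (z0 i - z i)).
  apply: filter_forall => i; have [Oz0 near0] := hz0 i.
  have := @nbhs_right_step _ _ (z0 i) (z0 i - z i) _ near0.
  apply: filterS => e; apply.
  exists 2, (fun k => if k == ord0 then 1 + e else - e),
    (fun k => if k == ord0 then z0 i else z i); split.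
  - by move=> k; case: ifP.
  - by rewrite !big_ord_recl big_ord0/=; ring.
  - rewrite !big_ord_recl big_ord0/= addr0.
    by apply/matrixP => a b; rewrite !mxE; ring.
move=> hnear; near (0 : R)^'+ => e; exists e.
  by near: e; exact: nbhs_right_gt.
by near: e.
Unshelve. all: by end_near. Qed.

(** Separate the epigraph of the value function, which maps a perturbation u of
the resource to the optimal value under the constraint
sum z = sum d + u. Optimality says that the value function is at least the
optimum at u = 0, and Slater's condition puts 0 in the relative interior of its
domain. The resulting inequality concerns all the agents together; moving a
single agent away from ystar isolates its own gap. *)
Lemma multiplier_exists (f : 'I_N -> 'rV[R]_n -> R)
  (Omega U : 'I_N -> set 'rV[R]_n) (d ystar : 'I_N -> 'rV[R]_n) :
  (forall i, convex_set (Omega i)) -> (forall i, Omega i `<=` U i) ->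
  (forall i, convex_function (U i) (f i)) ->
  slater Omega d -> optimal f Omega d ystar ->
  exists lam, forall i z, Omega i z -> 0 <= gap (f i) lam (ystar i) z.
Proof.
move=> cO OU cf [z0 [hz0 sz0]] [[sy Oy] opt].
have [||| lam hlam] := separation n (fun u r => exists z,
  [/\ forall i, Omega i (z i), u = \sum_i (z i) - \sum_i (d i)
    & \sum_i f i (z i) - \sum_i f i (ystar i) <= r]).
- move=> _ r _ q t t01 [y [Hy -> hr]] [z [Hz -> hq]].
  exists (fun i => y i + t *: (z i - y i)); split.
  + by move=> i; exact: convex_setP.
  + rewrite big_split/= -scaler_sumr sumrB.
    by apply/matrixP => a b; rewrite !mxE; ring.
  + have : \sum_i f i (y i + t *: (z i - y i)) <=
      \sum_i f i (y i) + t * (\sum_i f i (z i) - \sum_i f i (y i)).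
      rewrite -sumrB mulr_sumr -big_split/=; apply: ler_sum => i _.
      exact: (convex_functionP _ _ (cf i) _ _ _ t01 (OU _ _ (Hy i)) (OU _ _ (Hz i))).
    move: hr hq t01; move: (\sum_i _) (\sum_i _) (\sum_i _) (\sum_i _) => a b c e.
    by move=> hr hq /andP[t0 t1] h; nra.
- move=> r [z [Hz /esym/eqP]]; rewrite subr_eq0 => /eqP sz; apply: le_trans.
  by rewrite subr_ge0; apply: opt.
- move=> _ r [z [Hz -> _]]; have [e e0 He] := slater_step _ _ _ hz0 Hz.
  exists e, (\sum_i f i (z0 i + e *: (z0 i - z i)) - \sum_i f i (ystar i)).
  split => //; exists (fun i => z0 i + e *: (z0 i - z i)); split => //.
  rewrite big_split/= -scaler_sumr sumrB sz0.
  by apply/matrixP => a b; rewrite !mxE; ring.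
exists lam => i z Oz; pose y k := if k == i then z else ystar k.
have := hlam (\sum_k y k - \sum_k d k) (\sum_k f k (y k) - \sum_k f k (ystar k)).
have -> : \sum_k y k - \sum_k d k = z - ystar i.
  rewrite -sy -sumrB (bigD1 i)//= big1 ?addr0 ?/y ?eqxx// => k /negbTE ki.
  by rewrite ki subrr.
have -> : \sum_k f k (y k) - \sum_k f k (ystar k) = f i z - f i (ystar i).
  rewrite -sumrB (bigD1 i)//= big1 ?addr0 ?/y ?eqxx// => k /negbTE ki.
  by rewrite ki subrr.
rewrite /gap subr_ge0; apply; exists y; split.
- by move=> k; rewrite /y; case: eqP => [->|].
- rewrite -sy -sumrB (bigD1 i)//= big1 ?addr0 ?/y ?eqxx// => k /negbTE ki.
  by rewrite ki subrr.
- rewrite -sumrB (bigD1 i)//= big1 ?addr0 ?/y ?eqxx// => k /negbTE ki.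
  by rewrite ki subrr.
Qed.

End Multiplier.

(** * Absolutely continuous functions *)

Section RealInduction.
Context {R : realType}.

(** The supremum of the points reached from a cannot lie before b. *)
Lemma real_induction (P : R -> Prop) (a b : R) : a <= b -> P a ->
  (forall t, a <= t <= b -> exists2 e : R, 0 < e & forall s s',
    a <= s <= t -> t <= s' <= b -> t - s < e -> s' - t < e -> P s -> P s') ->
  P b.
Proof.
move=> ab Pa step; pose S := [set t | a <= t <= b /\ P t].
have Sa : S a by split => //; rewrite lexx.
have supS : has_sup S by split; [exists a|exists b => t [/andP[]]].
have ac : a <= sup S by apply: ub_le_sup => //; case: supS.
have cb : sup S <= b by apply: ge_sup; [exists a|move=> t [/andP[]]].
have acb : a <= sup S <= b by rewrite ac.
have [e e0 he] := step _ acb.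
have [s [/andP[sa sb] Ps] cs] := sup_adherent e0 supS.
have sc : s <= sup S by apply: ub_le_sup; [case: supS|split => //; rewrite sa].
pose s' := Num.min b (sup S + e / 2).
have cs' : sup S <= s' by rewrite le_min cb/= lerDl; lra.
have s'b : s' <= b by rewrite ge_min lexx.
have s'e : s' <= sup S + e / 2 by rewrite ge_min lexx orbT.
have Ps' : P s'.
  by apply: (he s) => //; rewrite ?sa ?sc ?cs' ?s'b//; lra.
have s'c : s' <= sup S.
  by apply: ub_le_sup; [case: supS|split => //; rewrite s'b andbT; lra].
suff <- : s' = b by [].
move: s'c; rewrite /s' ge_min => /orP[bc|]; last by lra.
by apply/min_idPl; lra.
Qed.

End RealInduction.

Section AbsoluteContinuityTheory.
Context {R : realType}.

Lemma abs_continuous_uniform {V : normedModType R} (a b : R) (g : R -> V) :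
  abs_continuous a b g -> forall e : R, 0 < e -> exists2 del : R, 0 < del &
  forall l r, a <= l -> l <= r -> r <= b -> r - l < del -> `|g r - g l| < e.
Proof.
move=> ac e e0; have [del del0 hdel] := ac e e0; exists del => // l r al lr rb lrd.
have := hdel 1 (fun=> l) (fun=> r); rewrite !big_ord1; apply => //.
by move=> i j _ _ _; rewrite !ord1.
Qed.

Lemma abs_continuous_bounded {V : normedModType R} (a b : R) (g : R -> V) :
  abs_continuous a b g -> exists M, forall t, a <= t <= b -> `|g t| <= M.
Proof.
move=> ac; have [ab|ba] := leP a b; last first.
  by exists 0 => t /andP[h1 h2]; move: (le_trans h1 h2); rewrite leNgt ba.
have [del del0 hdel] := abs_continuous_uniform _ _ _ ac 1 ltr01.
apply: (real_induction (fun t => exists M, forall u, a <= u <= t -> `|g u| <= M)) ab _ _.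
  by exists `|g a| => u; rewrite -eq_le => /eqP ->.
move=> t /andP[at_ tb]; exists (del / 2); first by rewrite divr_gt0.
move=> s s' /andP[sa st] /andP[ts' s'b] ds ds' [M hM].
exists (`|g s| + (`|M| + 1)) => u /andP[au us'].
have M0 := normr_ge0 M.
have [us|su] := leP u s.
  have := hM u; rewrite au us => /(_ isT); have := ler_norm M.
  by have := normr_ge0 (g s); lra.
have := hdel s u sa (ltW su) (le_trans us' s'b); have du : u - s < del by lra.
move=> /(_ du) h; rewrite -[g u](subrK (g s)) (le_trans (ler_normD _ _))//; lra.
Qed.

(** The closure properties below come from this domination by one or two
absolutely continuous functions. *)
Lemma abs_continuous_dominated {V1 V2 W : normedModType R} (a b K : R)
    (g1 : R -> V1) (g2 : R -> V2) (g : R -> W) :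
  (forall l r, a <= l -> l <= r -> r <= b ->
    `|g r - g l| <= K * (`|g1 r - g1 l| + `|g2 r - g2 l|)) ->
  abs_continuous a b g1 -> abs_continuous a b g2 -> abs_continuous a b g.
Proof.
move=> hg ac1 ac2 e e0.
have K1 : 0 < `|K| + 1 by rewrite ltr_wpDl.
have e' : 0 < e / (2 * (`|K| + 1)) by rewrite divr_gt0// mulr_gt0.
have [d1 d10 h1] := ac1 _ e'; have [d2 d20 h2] := ac2 _ e'.
exists (Num.min d1 d2); first by rewrite lt_min d10.
move=> m l r hlr tlr; rewrite lt_min => /andP[/(h1 _ _ _ hlr tlr) s1 /(h2 _ _ _ hlr tlr) s2].
apply: (@le_lt_trans _ _ ((`|K| + 1) * (\sum_(k < m) `|g1 (r k) - g1 (l k)| +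
    \sum_(k < m) `|g2 (r k) - g2 (l k)|))).
  rewrite -big_split mulr_sumr; apply: ler_sum => k _.
  have [al [lr rb]] := hlr k; apply: le_trans (hg _ _ al lr rb) _.
  rewrite ler_wpM2r ?addr_ge0//; have := ler_norm K; lra.
have -> : e = (`|K| + 1) * (e / (2 * (`|K| + 1)) + e / (2 * (`|K| + 1))).
  by field; rewrite gt_eqF.
by rewrite ltr_pM2l// ltrD.
Qed.

Lemma abs_continuous_lipschitz {V W : normedModType R} (a b K : R)
    (h : R -> V) (g : R -> W) :
  (forall l r, a <= l -> l <= r -> r <= b -> `|g r - g l| <= K * `|h r - h l|) ->
  abs_continuous a b h -> abs_continuous a b g.
Proof.
move=> hg ac; apply: (abs_continuous_dominated a b (K / 2) h h) => // l r al lr rb.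
by apply: le_trans (hg _ _ al lr rb) _; rewrite -mulr2n -mulr_natr; lra.
Qed.

Lemma abs_continuous_id (a b : R) : abs_continuous a b (@id R).
Proof.
move=> e e0; exists e => // m l r hlr _; congr (_ < _).
by apply: eq_bigr => k _; rewrite ger0_norm// subr_ge0; case: (hlr k) => _ [].
Qed.

Lemma abs_continuous_cst {V : normedModType R} (a b : R) (v : V) :
  abs_continuous a b (fun=> v).
Proof.
apply: (abs_continuous_lipschitz a b 0 id); last exact: abs_continuous_id.
by move=> l r _ _ _; rewrite subrr normr0 mul0r.
Qed.

Lemma abs_continuousD {V : normedModType R} (a b : R) (g h : R -> V) :
  abs_continuous a b g -> abs_continuous a b h ->
  abs_continuous a b (fun t => g t + h t).
Proof.
apply: (abs_continuous_dominated a b 1) => l r _ _ _.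
by rewrite mul1r opprD addrACA ler_normD.
Qed.

Lemma abs_continuousB {V : normedModType R} (a b : R) (g h : R -> V) :
  abs_continuous a b g -> abs_continuous a b h ->
  abs_continuous a b (fun t => g t - h t).
Proof.
apply: (abs_continuous_dominated a b 1) => l r _ _ _.
by rewrite mul1r opprD addrACA (le_trans (ler_normD _ _))// -opprD normrN.
Qed.

Lemma abs_continuousM (a b : R) (g h : R -> R) :
  abs_continuous a b g -> abs_continuous a b h ->
  abs_continuous a b (fun t => g t * h t).
Proof.
move=> ag ah; have [M hM] := abs_continuous_bounded _ _ _ ag.
have [K hK] := abs_continuous_bounded _ _ _ ah.
apply: (abs_continuous_dominated a b (`|M| + `|K|) g h) => // l r al lr rb.
have -> : g r * h r - g l * h l = (g r - g l) * h l + g r * (h r - h l) by ring.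
rewrite (le_trans (ler_normD _ _))// !normrM mulrDr lerD//.
  rewrite mulrC ler_wpM2r// (le_trans (hK _ _)) ?al ?(le_trans lr)//.
  by rewrite (le_trans (ler_norm K))// lerDr.
rewrite ler_wpM2r// (le_trans (hM _ _)) ?rb ?(le_trans al)//.
by rewrite (le_trans (ler_norm M))// lerDl.
Qed.

Lemma abs_continuous_sum {V : normedModType R} (I : finType) (a b : R)
    (g : I -> R -> V) : (forall i, abs_continuous a b (g i)) ->
  abs_continuous a b (fun t => \sum_i g i t).
Proof.
move=> ag; elim: (index_enum I) => [|i s IHs].
  rewrite (_ : (fun t => _) = fun=> 0); first exact: abs_continuous_cst.
  by apply/funext => t; rewrite big_nil.
rewrite (_ : (fun t => _) = fun t => g i t + \sum_(j <- s) g j t).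
  by apply: abs_continuousD.
by apply/funext => t; rewrite big_cons.
Qed.

Lemma abs_continuous_coord n (a b : R) (g : R -> 'rV[R]_n) k :
  abs_continuous a b g -> abs_continuous a b (fun t => g t ord0 k : R).
Proof.
apply: (abs_continuous_lipschitz a b 1 g) => l r _ _ _; rewrite mul1r.
by have := coord_le_norm (g r - g l) k; rewrite !mxE.
Qed.

End AbsoluteContinuityTheory.

Section Monotone.
Context {R : realType}.
Local Notation mu := (@lebesgue_measure R).

(** The two one-sided estimates at t are all that the covering argument uses of
the derivative. *)
Lemma derive_le0_near (g : R -> R) (t dg e : R) : is_derive t 1 g dg ->
  dg <= 0 -> 0 < e -> exists2 del : R, 0 < del & forall s,
    (t <= s -> s - t < del -> g s - g t <= e * (s - t)) /\
    (s <= t -> t - s < del -> g t - g s <= e * (t - s)).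
Proof.
move=> hd dg0 e0.
have : h^-1 *: (g (h *: 1 + t) - g t) @[h --> 0^'] --> dg.
  by rewrite -(@derive_val _ _ _ _ _ _ _ hd); exact: (@ex_derive _ _ _ _ _ _ _ hd).
move=> /cvgrPdist_le/(_ _ e0)[/= del del0 hdel]; exists del => // s.
have hs : s != t -> `|s - t| < del -> (s - t)^-1 * (g s - g t) <= e.
  move=> st std; have := hdel (s - t).
  rewrite /ball_/= sub0r normrN subr_eq0 => /(_ std st).
  rewrite /GRing.scale/= mulr1 subrK ler_norml => /andP[h _]; lra.
split=> st std.
  have [->|ts] := eqVneq s t; first by rewrite !subrr mulr0.
  have := hs ts; rewrite ger0_norm ?subr_ge0// => /(_ std).
  have h0 : 0 < s - t by rewrite subr_gt0 lt_neqAle eq_sym ts.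
  by rewrite mulrC ler_pdivrMr.
have [->|ts] := eqVneq s t; first by rewrite !subrr mulr0.
have := hs ts; rewrite distrC ger0_norm ?subr_ge0// => /(_ std).
have h0 : s - t < 0 by rewrite subr_lt0 lt_neqAle ts.
by rewrite mulrC ler_ndivrMr//; lra.
Qed.

(** The invariant of the real induction below: O is an open set around the points
at which nothing is known on the derivative, and the increment of g inside O is
charged to intervals on which absolute continuity will make it small. *)
Definition creeping (g : R -> R) (O : set R) (a e t : R) : Prop :=
  exists (m : nat) (l r : 'I_m -> R),
  [/\ forall k, a <= l k /\ l k <= r k /\ r k <= t,
      forall k, `]l k, r k[ `<=` O,
      trivIset setT (fun k => `]l k, r k[%classic)
    & g t - g a <= e * (t - a) + \sum_(k < m) `|g (r k) - g (l k)|].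

(** Either the slope estimate is extended, or ]s, s'[ joins the family of
intervals. *)
Lemma creeping_step g O a e s s' : 0 < e -> a <= s -> s <= s' -> creeping g O a e s ->
  g s' - g s <= e * (s' - s) \/ `]s, s'[ `<=` O -> creeping g O a e s'.
Proof.
move=> e0 sa ss' [m [l [r [hlr lrO tlr hg]]]] [hs|hO].
  exists m, l, r; split => //; last by lra.
  by move=> k; have [? [? ?]] := hlr k; split => //; split => //; lra.
exists m.+1, (fun k => oapp l s (unlift ord0 k)), (fun k => oapp r s' (unlift ord0 k)).
split.
- move=> k; case: (unliftP ord0 k) => [j _|_] /=.
    by have [? [? ?]] := hlr j; split => //; split => //; lra.
  by [].
- by move=> k; case: (unliftP ord0 k) => [j _|_] /=.
- move=> i j _ _; case: (unliftP ord0 i) => [i'|] ->; case: (unliftP ord0 j) => [j'|] -> //=.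
  + by move=> h; congr lift; exact: (tlr i' j' I I h).
  + move=> [x [/=]]; rewrite !in_itv/= => /andP[_ xr] /andP[sx _].
    by exfalso; have [_ [_ h]] := hlr i'; lra.
  + move=> [x [/=]]; rewrite !in_itv/= => /andP[sx _] /andP[_ xr].
    by exfalso; have [_ [_ h]] := hlr j'; lra.
- rewrite big_ord_recl unlift_none/=.
  under eq_bigr do rewrite liftK/=.
  have := ler_norm (g s' - g s).
  have : 0 <= e * (s' - s) by rewrite mulr_ge0 ?subr_ge0// ltW.
  by lra.
Qed.

Lemma sum_length_le (O : set R) m (l r : 'I_m -> R) : open O ->
  (forall k, l k <= r k) -> (forall k, `]l k, r k[ `<=` O) ->
  trivIset setT (fun k => `]l k, r k[%classic) ->
  ((\sum_(k < m) (r k - l k))%:E <= mu O)%E.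
Proof.
move=> oO lr lrO tlr.
have mO : measurable O by exact: open_measurable.
have -> : ((\sum_(k < m) (r k - l k))%:E =
    mu (\big[setU/set0]_(k < m) `]l k, r k[%classic))%E.
  rewrite measure_bigsetU_ord//= -sumEFin; apply: eq_bigr => k _.
  rewrite lebesgue_measure_itv/= lte_fin lt_neqAle lr andbT.
  by case: eqP => //= ->; rewrite subrr.
apply: le_measure; rewrite ?inE//.
  by apply: bigsetU_measurable.
elim/big_ind : _ => [|A B AO BO|k _]; [by []| |exact: lrO].
by move=> x [/AO|/BO].
Qed.

(** Cover the exceptional null set by an open set O so small that absolute
continuity bounds by e the variation over disjoint intervals inside O. By real
induction [creeping] reaches b: at a point of O a neighbouring interval is
inside O, and at any other point the derivative controls the increment. Hence
g b - g a <= e (b - a) + e for every e. *)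
Theorem ae_derive_le0_nonincreasing (g : R -> R) (a b : R) : a <= b ->
  abs_continuous a b g ->
  {ae mu, forall t : R, a < t < b -> exists2 dg, is_derive t 1 g dg & dg <= 0} ->
  g b <= g a.
Proof.
move=> ab ac [Z [mZ Z0 hZ]].
pose E := Z `|` [set a; b].
have mab : measurable ([set a; b] : set R) by exact: measurableU.
have mE : measurable E by exact: measurableU.
have E0 : mu E = 0%E.
  apply/eqP; rewrite -measure_le0 (le_trans (measureU2 _ _ _))//.
  rewrite [X in (X + _)%E]Z0 add0e (le_trans (measureU2 _ _ _))//.
  by rewrite [X in (X + _)%E]lebesgue_measure_set1 [X in (_ + X)%E]lebesgue_measure_set1 adde0.
suff main e : 0 < e -> g b - g a <= e * (b - a) + e.
  rewrite -subr_le0; apply/ler_addgt0Pr => e e0; rewrite add0r.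
  have h : 0 < b - a + 1 by lra.
  have := main (e / (b - a + 1)); rewrite divr_gt0// => /(_ isT) /le_trans; apply.
  by rewrite -[X in _ + X]mulr1 -mulrDr divfK// gt_eqF.
move=> e0; have [del del0 hdel] := ac _ e0.
have [|O [oO EO OE]] := lebesgue_regularity_outer mE _ del0.
  by rewrite [X in (X < _)%E]E0 ltry.
have Odel : (mu O < del%:E)%E.
  have mO : measurable O by exact: open_measurable.
  rewrite -(setDUK EO) (le_lt_trans (measureU2 _ _ _))//; first exact: measurableD.
  by rewrite [X in (X + _)%E]E0 add0e.
have [m [l [r [hlr lrO tlr hg]]]] : creeping g O a e b.
  apply: (real_induction (creeping g O a e)) ab _ _.
    exists 0%N, (fun=> 0), (fun=> 0); split; try by case.
    by rewrite !subrr mulr0 big_ord0 addr0.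
  move=> t /andP[at_ tb]; have [Et|nEt] := pselect (E t).
    have /(open_nbhs_nbhs (A := O)) /nbhs_ballP [c /= c0 hc] : open_nbhs t O.
      by split => //; exact: EO.
    exists c => // s s' /andP[sa st] /andP[ts' s'b] sc s'c Ps.
    apply: (creeping_step _ _ _ _ s) => //; first exact: le_trans ts'.
    right => x /=; rewrite in_itv/= => /andP[sx xs']; apply: hc.
    by rewrite /ball/= ltr_norml; lra.
  have [dg hdg dg0] : exists2 dg, is_derive t 1 g dg & dg <= 0.
    have [Zt|nZt] := pselect (Z t); first by exfalso; apply: nEt; left.
    apply: contrapT => hn; apply: nZt; apply: hZ => /= h; apply: hn; apply: h.
    rewrite !lt_neqAle at_ tb !andbT; apply/andP; split; apply/eqP => h.
      by apply: nEt; right; left.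
    by apply: nEt; right; right.
  have [c c0 hc] := derive_le0_near _ _ _ _ hdg dg0 e0.
  exists c => // s s' /andP[sa st] /andP[ts' s'b] sc s'c Ps.
  apply: (creeping_step _ _ _ _ s) => //; first exact: le_trans ts'.
  left; have [_ /(_ st sc)] := hc s; have [/(_ ts' s'c) + _] := hc s'; lra.
have hs : \sum_(k < m) (r k - l k) < del.
  rewrite -lte_fin; apply: le_lt_trans Odel; apply: sum_length_le => // k.
  by have [_ []] := hlr k.
by have := hdel _ _ _ hlr tlr hs; lra.
Qed.

End Monotone.

(** * Graph Laplacians *)

Section Laplacian.
Context {R : realType} {N : nat} (a : 'M[R]_N).
Implicit Types (u v : 'I_N -> R).

Definition lap u (i : 'I_N) : R := \sum_j a i j * (u i - u j).

Definition mean u : R := (\sum_i u i) / N%:R.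

Lemma lapB u v i : lap (fun j => u j - v j) i = lap u i - lap v i.
Proof. by rewrite /lap -sumrB; apply: eq_bigr => j _; ring. Qed.

Lemma lapD u v i : lap (fun j => u j + v j) i = lap u i + lap v i.
Proof. by rewrite /lap -big_split; apply: eq_bigr => j _ /=; ring. Qed.

Lemma lapZ c u i : lap (fun j => c * u j) i = c * lap u i.
Proof. by rewrite /lap mulr_sumr; apply: eq_bigr => j _; ring. Qed.

Lemma lap_cst c i : lap (fun=> c) i = 0.
Proof. by rewrite /lap big1// => j _; rewrite subrr mulr0. Qed.

Hypothesis a_und : undirected_graph a.

Lemma sum_lap u : \sum_i lap u i = 0.
Proof.
have e : \sum_i lap u i = - \sum_i lap u i.
  transitivity (\sum_i \sum_j a j i * (u j - u i)); first exact: exchange_big.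
  rewrite -sumrN; apply: eq_bigr => i _; rewrite /lap -sumrN.
  by apply: eq_bigr => j _; rewrite (a_und.2 j i); ring.
lra.
Qed.

(** This lemma and the next one exchange the two summation indices, which the
symmetry of the weights allows. *)
Lemma lap_sym u v : \sum_i u i * lap v i = \sum_i lap u i * v i.
Proof.
have e : \sum_i \sum_j a i j * (u i * v j) = \sum_i \sum_j a i j * (u j * v i).
  rewrite exchange_big; apply: eq_bigr => i _; apply: eq_bigr => j _ /=.
  by rewrite (a_und.2 j i).
transitivity (\sum_i \sum_j a i j * (u i * v i) - \sum_i \sum_j a i j * (u i * v j)).
  rewrite -sumrB; apply: eq_bigr => i _; rewrite mulr_sumr -sumrB.
  by apply: eq_bigr => j _; ring.
rewrite e -sumrB; apply: eq_bigr => i _; rewrite mulr_suml -sumrB.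
by apply: eq_bigr => j _; ring.
Qed.

Lemma lap_energy u :
  2 * \sum_i u i * lap u i = \sum_i \sum_j a i j * (u i - u j) ^+ 2.
Proof.
have e : \sum_i u i * lap u i = \sum_i \sum_j a i j * (u j * (u j - u i)).
  transitivity (\sum_i \sum_j a i j * (u i * (u i - u j))).
    by apply: eq_bigr => i _; rewrite mulr_sumr; apply: eq_bigr => j _; ring.
  rewrite exchange_big; apply: eq_bigr => i _; apply: eq_bigr => j _ /=.
  by rewrite (a_und.2 j i).
rewrite mulr2n mulrDl mul1r {2}e -big_split; apply: eq_bigr => i _ /=.
by rewrite mulr_sumr -big_split; apply: eq_bigr => j _ /=; ring.
Qed.

Lemma lap_ge0 u : 0 <= \sum_i u i * lap u i.
Proof.
suff : 0 <= 2 * \sum_i u i * lap u i by lra.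
rewrite lap_energy; apply: sumr_ge0 => i _; apply: sumr_ge0 => j _.
by rewrite mulr_ge0 ?sqr_ge0//; case: a_und.
Qed.

Hypothesis a_con : connected_graph a.

(** The energy vanishes, so u takes the same value at the two ends of each edge. *)
Lemma lap_eq0 u : (forall i, lap u i = 0) -> forall i j, u i = u j.
Proof.
move=> u0 i j; have := lap_energy u.
rewrite [in LHS]big1 ?mulr0; last by move=> k _; rewrite u0 mulr0.
have ge0 k l : 0 <= a k l * (u k - u l) ^+ 2.
  by rewrite mulr_ge0 ?sqr_ge0//; case: a_und.
move=> /esym/eqP; rewrite psumr_eq0 => [/allP h|k _]; last exact: sumr_ge0.
have edge k l : 0 < a k l -> u k = u l.
  move=> akl; have /implyP/(_ isT) := h k (mem_index_enum _).
  rewrite psumr_eq0// => /allP/(_ l (mem_index_enum _))/implyP/(_ isT).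
  by rewrite mulf_eq0 gt_eqF//= sqrf_eq0 subr_eq0 => /eqP.
have cl : fingraph.closed [rel i' j' : 'I_N | 0 < a i' j'] [pred k | u k == u i].
  by move=> k l /= /edge; rewrite !inE => ->.
by have := closed_connect cl (a_con i j); rewrite !inE eqxx => /esym/eqP.
Qed.

Hypothesis N_gt0 : (0 < N)%N.

Lemma N_neq0 : N%:R != 0 :> R.
Proof. by rewrite pnatr_eq0 -lt0n. Qed.

(** The Laplacian is singular, with the constants as kernel, but adding the
all-ones matrix makes it invertible: if v is in the kernel of the sum, summing
the coordinates gives sum v = 0, then v is in the kernel of the Laplacian,
hence constant and zero. The inverse of the sum inverts the Laplacian on the
vectors of sum zero. *)
Lemma lap_inverse : exists M : 'M[R]_N,
  (forall u i, \sum_j lap u j * M j i = u i - mean u) /\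
  (forall u, \sum_i u i = 0 -> forall i, lap (fun k => \sum_j u j * M j k) i = u i).
Proof.
pose A : 'M[R]_N := \matrix_(i, j) (lap (fun k => (k == i)%:R) j + 1).
have AE (v : 'rV[R]_N) j :
    (v *m A) ord0 j = lap (fun k => v ord0 k) j + \sum_k v ord0 k.
  have dE (k : 'I_N) : \sum_i v ord0 i * (k == i)%:R = v ord0 k.
    rewrite (bigD1 k)//= eqxx mulr1 big1 ?addr0// => i /negbTE.
    by rewrite eq_sym => ->; rewrite mulr0.
  rewrite mxE; transitivity (\sum_i (v ord0 i * lap (fun k => (k == i)%:R) j + v ord0 i)).
    by apply: eq_bigr => i _; rewrite mxE mulrDr mulr1.
  rewrite big_split/=; congr (_ + _).
  transitivity (\sum_i \sum_k v ord0 i * (a j k * ((j == i)%:R - (k == i)%:R))).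
    by apply: eq_bigr => i _; rewrite mulr_sumr.
  rewrite exchange_big; apply: eq_bigr => k _ /=.
  rewrite -(dE j) -(dE k) -sumrB mulr_sumr; apply: eq_bigr => i _; ring.
have sum0 (v : 'rV[R]_N) (w : 'I_N -> R) : (forall j, (v *m A) ord0 j = w j) ->
    \sum_j w j = 0 -> \sum_k v ord0 k = 0.
  move=> vw w0; have : \sum_j (v *m A) ord0 j = 0 by under eq_bigr do rewrite vw.
  under eq_bigr do rewrite AE.
  rewrite big_split/= sum_lap add0r sumr_const card_ord -mulr_natr => /eqP.
  by rewrite mulf_eq0 (negbTE N_neq0) orbF => /eqP.
have Au : A \in unitmx.
  rewrite -row_free_unit -kermx_eq0; apply/rowV0P => v /sub_kermxP vA.
  have vA0 j : (v *m A) ord0 j = 0 by rewrite vA mxE.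
  have sv : \sum_k v ord0 k = 0 by apply: sum0 vA0 _; rewrite big1.
  have vcst := lap_eq0 (fun k => v ord0 k) (fun j => _).
  have {}vcst : forall i j, v ord0 i = v ord0 j.
    by apply: vcst => j; have := AE v j; rewrite vA0 sv addr0.
  apply/rowP => i; rewrite mxE; move: sv.
  under eq_bigr do rewrite (vcst _ i).
  rewrite sumr_const card_ord -mulr_natr => /eqP.
  by rewrite mulf_eq0 (negbTE N_neq0) orbF => /eqP.
have AM u i : \sum_j (lap u j + \sum_k u k) * invmx A j i = u i.
  have : ((\row_k u k) *m A *m invmx A) ord0 i = u i by rewrite mulmxK// mxE.
  rewrite mxE => <-; apply: eq_bigr => j _; rewrite AE.
  congr ((_ + _) * _); last by apply: eq_bigr => k _; rewrite mxE.
  by apply: eq_bigr => k _; rewrite !mxE.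
exists (invmx A); split => [u i|u u0 i].
  have sM : \sum_j invmx A j i = N%:R^-1.
    have := AM (fun=> 1) i; under eq_bigr do rewrite lap_cst add0r sumr_const card_ord.
    by rewrite -mulr_sumr => h; apply: (mulfI N_neq0); rewrite h divff// N_neq0.
  have := AM u i; under eq_bigr do rewrite mulrDl.
  by rewrite big_split/= -mulr_sumr sM -/(mean u) => <-; rewrite addrK.
pose v := (\row_k u k) *m invmx A.
have vA j : (v *m A) ord0 j = u j by rewrite mulmxKV// mxE.
have := vA i; rewrite AE (sum0 _ _ vA u0) addr0 => <-.
have vE k : v ord0 k = \sum_j u j * invmx A j k.
  by rewrite mxE; apply: eq_bigr => j _; rewrite mxE.
by rewrite /lap; apply: eq_bigr => j _; rewrite !vE.
Qed.

End Laplacian.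

Section NetworkDecay.
Context {R : realType} {N : nat} (a M : 'M[R]_N) (k1 k2 k3 : R).
Hypotheses (k1_gt0 : 0 < k1) (k2_gt0 : 0 < k2) (k3_gt0 : 0 < k3).
Hypothesis a_und : undirected_graph a.
Hypothesis lapM : forall u i, \sum_j lap a u j * M j i = u i - mean u.
Hypothesis Mlap : forall u, \sum_i u i = 0 ->
  forall i, lap a (fun k => \sum_j u j * M j k) i = u i.

(** The combination rho of the introduction, for one coordinate of the vectors;
the sum over j is the preimage psi of omega under the Laplacian. *)
Definition integral_error (S omega : 'I_N -> R) (i : 'I_N) : R :=
  k3 * (S i - mean S) + k1 * \sum_j omega j * M j i.

Definition network_energy (S omega : 'I_N -> R) : R :=
  (\sum_i S i ^+ 2) / (2 * k1) +
  (\sum_i integral_error S omega i ^+ 2) / (2 * (k1 * k2 * k3)).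

(** The derivative of rho is - k2 k3 lap S, and the Laplacian is symmetric with
lap rho = k3 lap S + k1 omega. Hence the second term of the left-hand side
equals - (k3 / k1) S . lap S - S . omega, while the first is
S . (omega - eta) - (k2 / k1) S . lap S; in the sum S . omega disappears, and
S . lap S is nonnegative. *)
Lemma network_decay (S omega eta dS domega : 'I_N -> R) :
  \sum_i omega i = 0 ->
  (forall i, dS i = k1 * (omega i - eta i) - k2 * lap a S i) ->
  (forall i, domega i = - k3 * lap a (fun j => omega j - eta j) i) ->
  (\sum_i S i * dS i) / k1 +
  (\sum_i integral_error S omega i * integral_error dS domega i) / (k1 * k2 * k3)
    <= - \sum_i S i * eta i.
Proof.
move=> om0 hdS hdo.
have errE i : integral_error dS domega i = - (k2 * k3) * lap a S i.
  have mdS : mean dS = k1 * mean (fun j => omega j - eta j).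
    rewrite /mean; under eq_bigr do rewrite hdS.
    by rewrite sumrB -!mulr_sumr sum_lap// mulr0 subr0 mulrA.
  rewrite /integral_error mdS hdS.
  under eq_bigr do rewrite hdo -mulrA.
  by rewrite -mulr_sumr lapM; ring.
have lerr i : lap a (integral_error S omega) i = k3 * lap a S i + k1 * omega i.
  by rewrite lapD !lapZ lapB lap_cst Mlap// subr0.
have -> : \sum_i integral_error S omega i * integral_error dS domega i =
   - (k2 * k3) * (k3 * \sum_i S i * lap a S i + k1 * \sum_i S i * omega i).
  under eq_bigr do rewrite errE mulrCA.
  rewrite -mulr_sumr (lap_sym _ a_und (integral_error S omega)); congr (_ * _).
  rewrite !mulr_sumr -big_split; apply: eq_bigr => i _ /=; rewrite lerr; ring.
have -> : \sum_i S i * dS i = k1 * (\sum_i S i * omega i - \sum_i S i * eta i)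
    - k2 * \sum_i S i * lap a S i.
  rewrite -sumrB !mulr_sumr -sumrB; apply: eq_bigr => i _; rewrite hdS; ring.
set P := \sum_i S i * omega i; set H := \sum_i S i * eta i.
have := lap_ge0 _ a_und S; set L := \sum_i _ => L0.
rewrite [leLHS](_ : _ = - H - (k2 + k3) / k1 * L).
  by rewrite gerBl mulr_ge0// divr_ge0 ?addr_ge0// ltW.
by field; rewrite !gt_eqF.
Qed.

End NetworkDecay.

(** * Differentiation of the energies *)

Section DerivativeRules.
Context {R : realType}.
Implicit Types (f g u : R -> R) (t : R).

Lemma is_derive_addf f g t df dg : is_derive t 1 f df -> is_derive t 1 g dg ->
  is_derive t 1 (fun r => f r + g r) (df + dg).
Proof. by move=> hf hg; exact: is_deriveD. Qed.

Lemma is_derive_subf f g t df dg : is_derive t 1 f df -> is_derive t 1 g dg ->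
  is_derive t 1 (fun r => f r - g r) (df - dg).
Proof. by move=> hf hg; exact: is_deriveB. Qed.

Lemma is_derive_mull (c : R) f t df : is_derive t 1 f df ->
  is_derive t 1 (fun r => c * f r) (c * df).
Proof. by move=> hf; exact: is_deriveZ. Qed.

Lemma is_derive_mulr (c : R) f t df : is_derive t 1 f df ->
  is_derive t 1 (fun r => f r * c) (df * c).
Proof.
move=> hf; rewrite mulrC (_ : (fun r => _) = fun r => c * f r).
  exact: is_derive_mull.
by apply/funext => r; rewrite mulrC.
Qed.

Lemma is_derive_sqrf f t df : is_derive t 1 f df ->
  is_derive t 1 (fun r => f r ^+ 2) (2 * (f t * df)).
Proof.
move=> hf; rewrite (_ : (fun r => _) = f * f).
  by apply: is_derive_eq; rewrite /GRing.scale/=; ring.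
by apply/funext => r; rewrite expr2.
Qed.

Lemma is_derive_sumf (I : finType) (h : I -> R -> R) t (dh : I -> R) :
  (forall i, is_derive t 1 (h i) (dh i)) ->
  is_derive t 1 (fun r => \sum_i h i r) (\sum_i dh i).
Proof.
move=> hd; elim: (index_enum I) => [|i s IHs].
  rewrite big_nil (_ : (fun r => _) = cst 0); first exact: is_derive_cst.
  by apply/funext => r; rewrite big_nil.
rewrite big_cons (_ : (fun r => _) = fun r => h i r + \sum_(j <- s) h j r).
  exact: is_derive_addf.
by apply/funext => r; rewrite big_cons.
Qed.

Lemma is_derive_coord n (x : R -> 'rV[R]_n) t v k : is_derive t 1 x v ->
  is_derive t 1 (fun r => x r ord0 k) (v ord0 k).
Proof.
move=> hx; have dx : derivable x t 1 := @ex_derive _ _ _ _ _ _ _ hx.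
have := @derive_val _ _ _ _ _ _ _ hx; rewrite derive_mx// => <-; rewrite mxE.
apply: DeriveDef => //.
exact: (iffLR (derivable_mxP _ _ _) dx).
Qed.

Lemma is_derive_quotient f t df : is_derive t 1 f df <->
  h^-1 * (f (h + t) - f t) @[h --> 0^'] --> df.
Proof.
have E : (fun h : R => h^-1 * (f (h + t) - f t)) =
    (fun h => h^-1 *: ((f \o shift t) (h *: 1) - f t)).
  by apply/funext => h /=; rewrite /GRing.scale/= mulr1.
rewrite E; split => [hd|hc].
  by rewrite -(@derive_val _ _ _ _ _ _ _ hd); exact: (@ex_derive _ _ _ _ _ _ _ hd).
by apply: DeriveDef; [apply/cvg_ex; exists df|exact: cvg_lim].
Qed.

(** For q quadratic in the increment of a trajectory, this differentiates the
projection energy along it although the projection is not differentiable. *)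
Lemma is_derive_approx f u q t du : is_derive t 1 u du -> is_derive t 1 q 0 ->
  (forall s, `|f s - f t - (u s - u t)| <= q s - q t) ->
  is_derive t 1 f du.
Proof.
move=> /is_derive_quotient hu /is_derive_quotient hq fu.
apply/is_derive_quotient/cvgrPdist_le => e e0.
have e2 : 0 < e / 2 by rewrite divr_gt0.
move/cvgrPdist_le : hu => /(_ _ e2) hu; move/cvgrPdist_le : hq => /(_ _ e2) hq.
near=> h.
have -> : du - h^-1 * (f (h + t) - f t) = du - h^-1 * (u (h + t) - u t) -
   h^-1 * (f (h + t) - f t - (u (h + t) - u t)) by ring.
rewrite (le_trans (ler_normB _ _))// (splitr e) lerD//; first by near: h.
have : `|0 - h^-1 * (q (h + t) - q t)| <= e / 2 by near: h.
rewrite sub0r normrN !normrM; apply: le_trans; rewrite ler_wpM2l//.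
by rewrite (le_trans (fu _))// ler_norm.
Unshelve. all: by end_near. Qed.

Lemma is_derive_proj_energy n (A : set 'rV[R]_n) (ystar : 'rV[R]_n)
    (x : R -> 'rV[R]_n) t dx :
  closed A -> convex_set A -> A !=set0 -> is_derive t 1 x dx ->
  is_derive t 1 (fun r => proj_energy A ystar (x r))
    (dot (Defs.proj A (x t) - ystar) dx).
Proof.
move=> cA cvA A0 hx; set c := _ - ystar.
apply: (is_derive_approx _ (fun r => dot c (x r)) (fun r => dot (x r - x t) (x r - x t))).
- apply: is_derive_sumf => k; apply: is_derive_mull; exact: is_derive_coord.
- rewrite (_ : (fun r => _) = fun r => \sum_k (x r ord0 k - x t ord0 k) ^+ 2); last first.
    by apply/funext => r; apply: eq_bigr => k _; rewrite !mxE expr2.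
  have s0 : \sum_(k < n) 2 * ((x t ord0 k - x t ord0 k) * (dx ord0 k - 0)) = 0.
    by rewrite big1// => k _; rewrite subrr mul0r mulr0.
  rewrite -[X in is_derive _ _ _ X]s0.
  apply: is_derive_sumf => k; apply: is_derive_sqrf; apply: is_derive_subf.
  exact: is_derive_coord.
- move=> s; rewrite subrr.
  have -> : dot (0 : 'rV[R]_n) 0 = 0 by rewrite /dot big1// => k _; rewrite mxE mul0r.
  by rewrite subr0 -dotBr; exact: proj_energy_smooth.
Qed.

End DerivativeRules.

Section NetworkDerivative.
Context {R : realType} {N : nat} (M : 'M[R]_N) (k1 k2 k3 : R).

Lemma is_derive_network_energy (S omega : R -> 'I_N -> R) (t : R)
    (dS domega : 'I_N -> R) : 0 < k1 -> 0 < k2 -> 0 < k3 ->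
  (forall i, is_derive t 1 (S ^~ i) (dS i)) ->
  (forall i, is_derive t 1 (omega ^~ i) (domega i)) ->
  is_derive t 1 (fun r => network_energy M k1 k2 k3 (S r) (omega r))
    ((\sum_i S t i * dS i) / k1 +
     (\sum_i integral_error M k1 k3 (S t) (omega t) i *
        integral_error M k1 k3 dS domega i) / (k1 * k2 * k3)).
Proof.
move=> k10 k20 k30 hS ho.
have E (u v : 'I_N -> R) (c : R) : c != 0 ->
    (\sum_i u i * v i) / c = (\sum_i 2 * (u i * v i)) * (2 * c)^-1.
  by move=> c0; rewrite -mulr_sumr; field.
rewrite E ?gt_eqF// (E _ _ (k1 * k2 * k3)) ?gt_eqF ?mulr_gt0//.
have herr i : is_derive t 1 (fun r => integral_error M k1 k3 (S r) (omega r) i)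
    (integral_error M k1 k3 dS domega i).
  apply: is_derive_addf; apply: is_derive_mull.
    apply: is_derive_subf => //; apply: is_derive_mulr; exact: is_derive_sumf.
  by apply: is_derive_sumf => j; apply: is_derive_mulr.
by apply: is_derive_addf; apply: is_derive_mulr; apply: is_derive_sumf => i;
  apply: is_derive_sqrf.
Qed.

Lemma abs_continuous_network_energy (S omega : R -> 'I_N -> R) (b c : R) :
  (forall i, abs_continuous b c (S ^~ i)) ->
  (forall i, abs_continuous b c (omega ^~ i)) ->
  abs_continuous b c (fun r => network_energy M k1 k2 k3 (S r) (omega r)).
Proof.
move=> hS ho.
have herr i : abs_continuous b c (fun r => integral_error M k1 k3 (S r) (omega r) i).
  apply: abs_continuousD; apply: abs_continuousM; try exact: abs_continuous_cst.
    apply: abs_continuousB => //; apply: abs_continuousM; last exact: abs_continuous_cst.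
    exact: abs_continuous_sum.
  by apply: abs_continuous_sum => j; apply: abs_continuousM => //; exact: abs_continuous_cst.
by apply: abs_continuousD; apply: abs_continuousM; try exact: abs_continuous_cst;
  apply: abs_continuous_sum => i; apply: abs_continuousM.
Qed.

End NetworkDerivative.

Section ProjectionTrajectory.
Context {R : realType} {n : nat} (A : set 'rV[R]_n).
Hypotheses (clA : closed A) (cvA : convex_set A) (A0 : A !=set0).

Lemma proj_lipschitz_norm p q :
  `|Defs.proj A p - Defs.proj A q| <= (n%:R + 1) * `|p - q|.
Proof.
apply: norm_le_dot; first by rewrite mulr_ge0// addr_ge0.
apply: le_trans (proj_nonexpansive A clA cvA A0 p q) _.
apply: le_trans (ler_norm _) _; apply: le_trans (dot_le_norm _ _) _.
rewrite exprMn expr2 -expr2 ler_wpM2r ?sqr_ge0//.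
have : 0 <= n%:R :> R by []. nra.
Qed.

Lemma abs_continuous_proj_energy (ystar : 'rV[R]_n) (x : R -> 'rV[R]_n) (b c : R) :
  abs_continuous b c x -> abs_continuous b c (fun r => proj_energy A ystar (x r)).
Proof.
move=> ax; have ap : abs_continuous b c (fun r => Defs.proj A (x r)).
  by apply: abs_continuous_lipschitz ax => l r _ _ _; exact: proj_lipschitz_norm.
have adot (y : R -> 'rV[R]_n) : abs_continuous b c y ->
    abs_continuous b c (fun r => dot (y r) (y r)).
  move=> ay; apply: abs_continuous_sum => k.
  by apply: abs_continuousM; exact: abs_continuous_coord.
apply: abs_continuousM; last exact: abs_continuous_cst.
apply: abs_continuousB; apply: adot; apply: abs_continuousB => //.
exact: abs_continuous_cst.
Qed.

End ProjectionTrajectory.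

(** * Scalar estimates and dissipation *)

Section ScalarEstimates.
Context {R : realType}.
Local Notation mu := (@lebesgue_measure R).
Implicit Types (u : R -> R).

Lemma ae_imply (P Q : R -> Prop) : (forall t, P t -> Q t) ->
  {ae mu, forall t, P t} -> {ae mu, forall t, Q t}.
Proof. by move=> PQ; apply: negligibleS => t; apply: contra_not; exact: PQ. Qed.

Lemma locally_abs_continuousW {V : normedModType R} (g : R -> V) (b c : R) :
  locally_abs_continuous g -> 0 <= b -> abs_continuous b c g.
Proof.
move=> hg b0 e e0; have [|del del0 hdel] := hg (Num.max c 1) _ _ e0.
  by rewrite lt_max ltr01 orbT.
exists del => // m l r hlr tlr; apply: hdel => // k.
have [bl [lr rc]] := hlr k; split; first exact: le_trans bl.
by split => //; rewrite le_max rc.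
Qed.

Lemma abs_continuous_expR (b c : R) : abs_continuous b c (@expR R).
Proof.
apply: (abs_continuous_lipschitz b c (expR c) id); last exact: abs_continuous_id.
move=> l r bl lr rc; rewrite !ger0_norm ?subr_ge0 ?ler_expR//.
apply: (@le_trans _ _ (expR r * (r - l))); last first.
  by rewrite ler_wpM2r ?subr_ge0 ?ler_expR.
have -> : expR l = expR r * expR (l - r) by rewrite -expRD addrC subrK.
rewrite -[X in X - _]mulr1 -mulrBr ler_wpM2l ?expR_ge0//.
by have := expR_ge1Dx (l - r); lra.
Qed.

(** Integrating factor: expR t * (u t - |H|) has a nonpositive derivative.
With |H| in place of H, its value at time 0 is at most |u 0|. *)
Lemma relaxation_bound u (H T : R) : 0 <= T -> abs_continuous 0 T u ->
  {ae mu, forall t : R, 0 < t < T -> exists2 h, is_derive t 1 u (h - u t) & h <= H} ->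
  u T <= `|H| + `|u 0|.
Proof.
move=> T0 ac hu; pose g t := expR t * (u t - `|H|).
have : g T <= g 0.
  apply: ae_derive_le0_nonincreasing T0 _ _.
    apply: abs_continuousM; first exact: abs_continuous_expR.
    by apply: abs_continuousB => //; exact: abs_continuous_cst.
  apply: ae_imply hu => t hu /hu[h hd hH].
  exists (expR t * (h - u t) + (u t - `|H|) * expR t); last first.
    have := expR_ge0 t; have := ler_norm H; nra.
  have hd' : is_derive t 1 (fun r => u r - `|H|) (h - u t).
    by rewrite -[h - u t]subr0; apply: is_derive_subf.
  exact: is_deriveM.
rewrite /g expR0 mul1r => gT.
have e1 : 1 <= expR T by rewrite -expR0 ler_expR.
have [|uT] := leP (u T) `|H|; first by move/le_trans; apply; rewrite lerDl.
have := ler_norm (u 0); have := normr_ge0 H; nra.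
Qed.

Lemma ae_derive_bounded_lipschitz u (L b c : R) : b <= c -> abs_continuous b c u ->
  {ae mu, forall t : R, b < t < c -> exists2 du, is_derive t 1 u du & `|du| <= L} ->
  `|u c - u b| <= L * (c - b).
Proof.
move=> bc ac hu; rewrite ler_norml; apply/andP; split.
- suff : - u c - L * c <= - u b - L * b by lra.
  apply: (ae_derive_le0_nonincreasing (fun t => - u t - L * t)) bc _ _.
    apply: abs_continuousB; last first.
      by apply: abs_continuousM; [exact: abs_continuous_cst|exact: abs_continuous_id].
    by apply: (abs_continuous_lipschitz _ _ 1) ac => l r _ _ _; rewrite mul1r -opprD normrN.
  apply: ae_imply hu => t hu /hu[du hd]; rewrite ler_norml => /andP[h1 h2].
  exists (- du - L * 1); last by lra.
  exact: is_derive_subf.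
- suff : u c - L * c <= u b - L * b by lra.
  apply: (ae_derive_le0_nonincreasing (fun t => u t - L * t)) bc _ _.
    apply: abs_continuousB => //.
    by apply: abs_continuousM; [exact: abs_continuous_cst|exact: abs_continuous_id].
  apply: ae_imply hu => t hu /hu[du hd]; rewrite ler_norml => /andP[h1 h2].
  exists (du - L * 1); last by lra.
  exact: is_derive_subf.
Qed.

(** Since V converges, from some time on it can no longer drop by del within a
delay tau; from then on z t is within e of q. *)
Lemma dissipation_cvg n (V : R -> R) (z : R -> 'rV[R]_n) (q : 'rV[R]_n) :
  (forall t, 0 <= t -> 0 <= V t) ->
  (forall t t', 0 <= t -> t <= t' -> V t' <= V t) ->
  (forall e : R, 0 < e -> exists tau del : R, [/\ 0 < tau, 0 < del &
     forall t, 0 <= t -> e ^+ 2 <= dot (z t - q) (z t - q) -> V (t + tau) + del <= V t]) ->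
  z t @[t --> +oo] --> q.
Proof.
move=> V0 Vdec drop; apply/cvgrPdist_lt => e e0.
have [tau [del [tau0 del0 hdrop]]] := drop e e0.
pose I := [set V t | t in [set t : R | 0 <= t]].
have hI : has_inf I.
  by split; [exists (V 0), 0 => /=|exists 0 => _ [t /= t0 <-]; exact: V0].
have [_ [T /= T0 <-] VT] := inf_adherent del0 hI.
near=> t; have tT : T <= t by near: t; apply: nbhs_pinfty_ge; exact: num_real.
have t0 : 0 <= t by exact: le_trans tT.
rewrite distrC; apply: norm_lt_dot => //; rewrite ltNge; apply/negP => /(hdrop _ t0).
have : inf I <= V (t + tau).
  by apply: ge_inf; [case: hI|exists (t + tau) => //=; lra].
have := Vdec _ _ T0 tT; lra.
Unshelve. all: by end_near. Qed.

End ScalarEstimates.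

Section Agent.
Context {R : realType} {n : nat} (U Omega : set 'rV[R]_n) (f : 'rV[R]_n -> R).
Hypotheses (clO : closed Omega) (cO : convex_set Omega) (OU : Omega `<=` U).

(** Two inequalities add up: the variational inequality of the projection,
tested at q, removes proj - x; the subgradient inequality, tested at q, removes
g. What is left of f and lam is the gap. *)
Lemma agent_dissipation (lam q x s g : 'rV[R]_n) : Omega q ->
  subgradient U f (Defs.proj Omega x) g ->
  dot (Defs.proj Omega x - q) (Defs.proj Omega x - x - g + s) <=
    dot (Defs.proj Omega x - q) (s - lam) - gap f lam q (Defs.proj Omega x).
Proof.
move=> Oq hg; have := proj_variational _ clO cO (ex_intro _ q Oq) x _ Oq.
have := hg _ (OU _ Oq); rewrite /gap; set P := Defs.proj Omega x => h1 h2.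
have -> : P - x - g + s = (s - lam) - (x - P) - g + lam.
  by apply/matrixP => i j; rewrite !mxE; ring.
rewrite [dot _ (_ + lam)]dotDr [dot _ (_ - g)]dotBr [dot _ (_ - (x - P))]dotBr.
have -> : dot (P - q) (x - P) = - dot (x - P) (q - P).
  by rewrite dotC -dotNr opprB.
have -> : dot (P - q) g = - dot g (q - P) by rewrite dotC -dotNr opprB.
rewrite [dot _ lam]dotC; move: h1 h2.
move: (dot g _) (dot (x - P) _) (dot lam _) (dot _ (s - lam)) (f P) (f q).
by move=> *; lra.
Qed.

End Agent.

(** * Trajectories *)

Section Trajectory.
Context {R : realType} {N n : nat} (f : 'I_N -> 'rV[R]_n -> R)
  (Omega U : 'I_N -> set 'rV[R]_n) (d ystar : 'I_N -> 'rV[R]_n)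
  (a M : 'M[R]_N) (k1 k2 k3 : R) (lam : 'rV[R]_n).
Local Notation mu := (@lebesgue_measure R).
Hypotheses (Omega_closed : forall i, closed (Omega i))
  (Omega_convex : forall i, convex_set (Omega i))
  (U_open : forall i, open (U i))
  (U_convex : forall i, convex_set (U i))
  (Omega_sub_U : forall i, Omega i `<=` U i)
  (f_convex : forall i, convex_function (U i) (f i))
  (f_lipschitz : forall i, locally_lipschitz (U i) (f i))
  (f_strict : forall i, strictly_convex_on (Omega i) (f i))
  (ystar_feasible : feasible Omega d ystar)
  (gap_ge0 : forall i z, Omega i z -> 0 <= gap (f i) lam (ystar i) z)
  (a_und : undirected_graph a)
  (lapM : forall u i, \sum_j lap a u j * M j i = u i - mean u)
  (Mlap : forall u, \sum_i u i = 0 ->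
    forall i, lap a (fun k => \sum_j u j * M j k) i = u i)
  (k1_gt0 : 0 < k1) (k2_gt0 : 0 < k2) (k3_gt0 : 0 < k3).
Context (x s w y : 'I_N -> R -> 'rV[R]_n).
Hypotheses (sol : solution k1 k2 k3 a f Omega d x s w y)
  (w_init : \sum_(i < N) w i 0 = 0).

Let P i t := Defs.proj (Omega i) (x i t).
Let Oy i : Omega i (ystar i). Proof. by case: ystar_feasible. Qed.
Let O0 i : Omega i !=set0. Proof. by exists (ystar i). Qed.
Let OP i t : Omega i (P i t). Proof. exact: proj_mem. Qed.
Let x_ac i b c : 0 <= b -> abs_continuous b c (x i).
Proof. by case: sol => h _ _ _ _; exact: locally_abs_continuousW. Qed.
Let s_ac i b c : 0 <= b -> abs_continuous b c (s i).
Proof. by case: sol => _ h _ _ _; exact: locally_abs_continuousW. Qed.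
Let w_ac i b c : 0 <= b -> abs_continuous b c (w i).
Proof. by case: sol => _ _ h _ _; exact: locally_abs_continuousW. Qed.

Let S k t i := (s i t - lam) ord0 k.
Let omega k t i := (w i t - (ystar i - d i)) ord0 k.
Let eta k t i := (P i t - ystar i) ord0 k.
Let dS k t i := k1 * (omega k t i - eta k t i) - k2 * lap a (S k t) i.
Let domega k t i := - k3 * lap a (fun j => omega k t j - eta k t j) i.

(** Written with S, omega and eta, the equations for s and w no longer contain d,
lam or ystar, since these form an equilibrium, and the coordinates decouple:
each one is a scalar system on the graph. The projections of x replace y, which
is tied to x at nonnegative times only. *)
Lemma solution_ae : {ae mu, forall t : R, 0 <= t ->
  [/\ forall i, exists2 g, subgradient (U i) (f i) (P i t) g /\ clarke_gradient (f i) (P i t) g &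
        is_derive t 1 (x i) (P i t - x i t - g + s i t),
      forall k i, is_derive t 1 (S k ^~ i) (dS k t i)
    & forall k i, is_derive t 1 (omega k ^~ i) (domega k t i)]}.
Proof.
case: sol => _ _ _ hy; apply: ae_imply => t ht t0.
have yP i : y i t = P i t by exact: hy.
split.
- move=> i; have [[g hg hx] _ _] := ht t0 i; rewrite yP in hg hx; exists g => //.
  by split => //; apply: clarke_subgradient => //; exact: Omega_sub_U.
- move=> k i; have [_ hs _] := ht t0 i.
  have -> : dS k t i = (k1 *: (w i t - y i t + d i)
               + k2 *: \sum_(j < N) a i j *: (s j t - s i t)) ord0 k - 0.
    rewrite subr0 mxE mxE [X in _ + X]mxE summxE yP /dS /omega /eta !mxE.
    rewrite /lap -mulrN -sumrN; congr (_ * _ + _ * _); first by ring.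
    by apply: eq_bigr => j _; rewrite /S !mxE; ring.
  rewrite (_ : S k ^~ i = fun r => s i r ord0 k - lam ord0 k); last first.
    by apply/funext => r; rewrite /S !mxE.
  by apply: is_derive_subf; exact: is_derive_coord.
- move=> k i; have [_ _ hw] := ht t0 i.
  have -> : domega k t i = (k3 *: \sum_(j < N) a i j *:
     ((w j t - y j t + d j) - (w i t - y i t + d i))) ord0 k - 0.
    rewrite subr0 mxE summxE /domega mulNr -mulrN /lap -sumrN; congr (_ * _).
    by apply: eq_bigr => j _; rewrite !yP /omega /eta !mxE; ring.
  rewrite (_ : omega k ^~ i = fun r => w i r ord0 k - (ystar i - d i) ord0 k); last first.
    by apply/funext => r; rewrite /omega !mxE.
  by apply: is_derive_subf; exact: is_derive_coord.
Qed.

Let S_ac k i b c : 0 <= b -> abs_continuous b c (S k ^~ i).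
Proof.
move=> b0; apply: (abs_continuous_coord _ _ _ (fun t => s i t - lam)).
by apply: abs_continuousB; [exact: s_ac|exact: abs_continuous_cst].
Qed.

Let omega_ac k i b c : 0 <= b -> abs_continuous b c (omega k ^~ i).
Proof.
move=> b0; apply: (abs_continuous_coord _ _ _ (fun t => w i t - (ystar i - d i))).
by apply: abs_continuousB; [exact: w_ac|exact: abs_continuous_cst].
Qed.

(** Conservation law: the weights being symmetric, the derivative of the sum of
the w i is zero, and ystar is feasible. *)
Lemma sum_omega k t : 0 <= t -> \sum_i omega k t i = 0.
Proof.
move=> t0.
have om0 : \sum_i omega k 0 i = 0.
  transitivity ((\sum_i (w i 0 - (ystar i - d i))) ord0 k).
    by rewrite summxE.
  by rewrite sumrB w_init sumrB ystar_feasible.1 subrr subr0 mxE.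
have : `|\sum_i omega k t i - \sum_i omega k 0 i| <= 0 * (t - 0).
  apply: (ae_derive_bounded_lipschitz (fun r => \sum_i omega k r i)) => //.
    by apply: abs_continuous_sum => i; exact: omega_ac.
  apply: ae_imply solution_ae => r hr /andP[r0 _].
  have [_ _ ho] := hr (ltW r0).
  exists (\sum_i domega k r i); first exact: is_derive_sumf.
  by rewrite -mulr_sumr sum_lap// mulr0 normr0.
by rewrite om0 mul0r subr0 normr_le0 => /eqP.
Qed.

Let V t := \sum_i proj_energy (Omega i) (ystar i) (x i t) +
  \sum_k network_energy M k1 k2 k3 (S k t) (omega k t).

Let G t := \sum_i gap (f i) lam (ystar i) (P i t).

(** The terms S . eta produced by the agents and by the network cancel. *)
Lemma lyapunov_ae : {ae mu, forall t : R, 0 <= t -> exists2 dV,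
  is_derive t 1 V dV & dV <= - G t}.
Proof.
apply: ae_imply solution_ae => t ht t0; have [hx hS ho] := ht t0.
have /choice[g hg] : forall i, exists g, subgradient (U i) (f i) (P i t) g /\
    is_derive t 1 (x i) (P i t - x i t - g + s i t).
  by move=> i; have [g [] hg] := hx i; exists g.
exists (\sum_i dot (P i t - ystar i) (P i t - x i t - g i + s i t) +
  \sum_k ((\sum_i S k t i * dS k t i) / k1 +
     (\sum_i integral_error M k1 k3 (S k t) (omega k t) i *
        integral_error M k1 k3 (dS k t) (domega k t) i) / (k1 * k2 * k3))).
  apply: is_derive_addf; apply: is_derive_sumf => i.
    apply: is_derive_proj_energy => //; exact: (hg i).2.
  exact: is_derive_network_energy.
apply: (@le_trans _ _ (\sum_i (dot (P i t - ystar i) (s i t - lam) -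
    gap (f i) lam (ystar i) (P i t)) - \sum_k \sum_i S k t i * eta k t i)).
  apply: lerD.
    apply: ler_sum => i _; apply: agent_dissipation => //; exact: (hg i).1.
  rewrite -sumrN; apply: ler_sum => k _; apply: network_decay => //.
  - exact: a_und.
  - exact: sum_omega.
rewrite sumrB exchange_big -/(G t) addrAC -sumrB big1 ?sub0r// => i _.
apply/eqP; rewrite subr_eq0; apply/eqP; apply: eq_bigr => k _.
by rewrite mulrC.
Qed.

Let V_ac b c : 0 <= b -> abs_continuous b c V.
Proof.
move=> b0; apply: abs_continuousD; apply: abs_continuous_sum => i.
  by apply: abs_continuous_proj_energy => //; exact: x_ac.
by apply: abs_continuous_network_energy => j; [exact: S_ac|exact: omega_ac].
Qed.

Lemma G_ge0 t : 0 <= G t.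
Proof. by apply: sumr_ge0 => i _; apply: gap_ge0. Qed.

Lemma lyapunov_drop (t t' del : R) : 0 <= t -> t <= t' ->
  (forall r, t < r < t' -> del <= G r) -> V t' + del * (t' - t) <= V t.
Proof.
move=> t0 tt' hG.
suff : V t' + del * t' <= V t + del * t by lra.
apply: (ae_derive_le0_nonincreasing (fun r => V r + del * r)) tt' _ _.
  apply: abs_continuousD; first exact: V_ac.
  by apply: abs_continuousM; [exact: abs_continuous_cst|exact: abs_continuous_id].
apply: ae_imply lyapunov_ae => r hr trt'; have r0 : 0 <= r by lra.
have [dV hV hdV] := hr r0; exists (dV + del * 1); last by have := hG _ trt'; lra.
by apply: is_derive_addf => //; exact: is_derive_mull.
Qed.

Lemma lyapunov_nonincreasing t t' : 0 <= t -> t <= t' -> V t' <= V t.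
Proof.
move=> t0 tt'; have := lyapunov_drop _ _ 0 t0 tt' (fun r _ => G_ge0 r).
by rewrite mul0r addr0.
Qed.

Let network_energy_part k t :
  (\sum_i S k t i ^+ 2) / (2 * k1) <= network_energy M k1 k2 k3 (S k t) (omega k t).
Proof.
have kk : 0 <= (2 * (k1 * k2 * k3))^-1 by rewrite invr_ge0 ltW// !mulr_gt0.
by rewrite lerDl mulr_ge0// sumr_ge0// => i _; exact: sqr_ge0.
Qed.

Let network_energy_ge0 k t : 0 <= network_energy M k1 k2 k3 (S k t) (omega k t).
Proof.
apply: le_trans (network_energy_part k t).
have kk : 0 <= (2 * k1)^-1 by rewrite invr_ge0 ltW// !mulr_gt0.
by rewrite mulr_ge0// sumr_ge0// => i _; exact: sqr_ge0.
Qed.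

Let proj_energy_ge0 i t : 0 <= proj_energy (Omega i) (ystar i) (x i t).
Proof.
apply: le_trans (proj_energy_ge _ (Omega_closed i) (Omega_convex i) (O0 i) _ _ (Oy i)).
by rewrite divr_ge0 ?dot_ge0.
Qed.

Lemma lyapunov_ge0 t : 0 <= V t.
Proof. by rewrite addr_ge0// sumr_ge0. Qed.

Lemma P_bounded i t : 0 <= t ->
  dot (P i t - ystar i) (P i t - ystar i) <= 2 * V 0.
Proof.
move=> t0; have := lyapunov_nonincreasing _ _ (lexx 0) t0.
have := proj_energy_ge _ (Omega_closed i) (Omega_convex i) (O0 i) _ (x i t) (Oy i).
have : proj_energy (Omega i) (ystar i) (x i t) <= V t.
  rewrite /V (bigD1 i)//= -addrA lerDl addr_ge0// sumr_ge0//.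
rewrite -/(P i t); lra.
Qed.

Lemma S_bounded i k t : 0 <= t -> S k t i ^+ 2 <= 2 * k1 * V 0.
Proof.
move=> t0; rewrite mulrC -ler_pdivrMr ?mulr_gt0//.
apply: le_trans (lyapunov_nonincreasing _ _ (lexx 0) t0).
apply: (@le_trans _ _ (network_energy M k1 k2 k3 (S k t) (omega k t))); last first.
  rewrite /V addrC (bigD1 k)//= -addrA lerDl addr_ge0// sumr_ge0//.
apply: le_trans (network_energy_part k t); rewrite ler_pM2r ?invr_gt0 ?mulr_gt0//.
by rewrite (bigD1 i)//= lerDl sumr_ge0// => j _; exact: sqr_ge0.
Qed.

(** V bounds y and s, and the Clarke gradients are bounded where y stays. *)
Lemma drift_bounded i : exists2 H : R, 0 <= H & {ae mu, forall t : R, 0 <= t ->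
  exists2 h : 'rV[R]_n, is_derive t 1 (x i) (h - x i t) & `|h| <= H}.
Proof.
have [K K0 hK] := clarke_bounded _ _ _ (ystar i) (U_open i) (f_convex i)
  (f_lipschitz i) (Omega_closed i) (Omega_sub_U i) (2 * V 0).
have V0 := lyapunov_ge0 0.
(* bounds of y, of the Clarke gradient and of s, in this order; writing
   c <= (c + 1) ^+ 2 avoids square roots *)
pose H := (`|ystar i| + (2 * V 0 + 1)) + K + ((2 * k1 * V 0 + 1) + `|lam|).
exists H; first by rewrite /H !addr_ge0// ?mulr_ge0// ltW// mulr_ge0.
apply: ae_imply solution_ae => t ht t0; have [hx _ _] := ht t0.
have [g [_ hg] hd] := hx i; exists (P i t - g + s i t).
  by rewrite (_ : _ - x i t = P i t - x i t - g + s i t) //;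
    apply/matrixP => j k; rewrite !mxE; ring.
rewrite (le_trans (ler_normD _ _))// lerD//.
  rewrite (le_trans (ler_normB _ _))// lerD//.
    rewrite -[P i t](subKr (ystar i)) (le_trans (ler_normB _ _))// lerD2l -normrN opprB.
    apply: norm_le_dot; first by lra.
    by apply: le_trans (P_bounded i t t0) _; rewrite expr2; nra.
  by apply: hK hg => //; exact: P_bounded.
rewrite -[s i t](subrK lam) (le_trans (ler_normD _ _))// lerD2r.
have kV : 0 <= 2 * k1 * V 0 by rewrite !mulr_ge0// ltW.
apply: norm_le_coord => [|k]; first by lra.
have := S_bounded i k t t0; rewrite /S -[X in X <= _]real_normK ?num_real//.
set c := `|_|; have : 0 <= c by exact: normr_ge0.
move: kV; set m := 2 * k1 * V 0; nra.
Qed.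

(** Each coordinate of x relaxes towards a bounded input, hence is bounded; so is
its derivative. *)
Lemma x_lipschitz i : exists2 L : R, 0 <= L & forall t t', 0 <= t -> t <= t' ->
  `|x i t' - x i t| <= L * (t' - t).
Proof.
have [H H0 hH] := drift_bounded i; pose L := H + `|H| + `|x i 0|.
have xb k t : 0 <= t -> `|x i t ord0 k| <= `|H| + `|x i 0|.
  move=> t0; have c0 := coord_le_norm (x i 0) k; rewrite ler_norml; apply/andP; split.
    rewrite lerNl; apply: le_trans (relaxation_bound (fun r => - x i r ord0 k) H t t0 _ _) _.
    - apply: (abs_continuous_lipschitz _ _ 1 (x i)) (x_ac _ _ _ (lexx 0)) => l r _ _ _.
      rewrite mul1r -opprD normrN.
      by have := coord_le_norm (x i r - x i l) k; rewrite !mxE.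
    - apply: ae_imply hH => r hr /andP[r0 _]; have [h hd hh] := hr (ltW r0).
      exists (- h ord0 k); last first.
        by have := coord_le_norm h k; have := ler_norm (- h ord0 k); rewrite normrN; lra.
      have := is_derive_coord _ _ _ _ k hd; rewrite !mxE => hdk.
      have -> : - h ord0 k - - x i r ord0 k = - (h ord0 k - x i r ord0 k) by ring.
      exact: is_deriveN.
    - by rewrite normrN lerD2l.
  apply: le_trans (relaxation_bound (fun r => x i r ord0 k) H t t0 _ _) _.
  - exact: abs_continuous_coord (x_ac _ _ _ (lexx 0)).
  - apply: ae_imply hH => r hr /andP[r0 _]; have [h hd hh] := hr (ltW r0).
    exists (h ord0 k); last first.
      by have := coord_le_norm h k; have := ler_norm (h ord0 k); lra.
    by have := is_derive_coord _ _ _ _ k hd; rewrite !mxE.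
  - by rewrite lerD2l.
exists L; first by rewrite /L !addr_ge0.
move=> t t' t0 tt'; apply: norm_le_coord => [|k].
  by rewrite mulr_ge0 ?subr_ge0// /L !addr_ge0.
rewrite !mxE; apply: (ae_derive_bounded_lipschitz (fun r => x i r ord0 k)) => //.
  exact: abs_continuous_coord (x_ac _ _ _ t0).
apply: ae_imply hH => r hr /andP[tr _]; have r0 : 0 <= r by lra.
have [h hd hh] := hr r0; exists ((h - x i r) ord0 k); first exact: is_derive_coord.
rewrite !mxE (le_trans (ler_normB _ _))// /L -addrA lerD ?xb//.
exact: le_trans (coord_le_norm _ _) hh.
Qed.

(** The Lipschitz estimate turns a distance e at time t into a distance at least
e / 2 during the time tau, so the gap of agent i is at least del on that
interval. *)
Lemma P_cvg i : P i t @[t --> +oo] --> ystar i.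
Proof.
apply: (dissipation_cvg n V) => [t _|t t'|e e0]; first exact: lyapunov_ge0.
  exact: lyapunov_nonincreasing.
have e4 : 0 < e ^+ 2 / 4 by rewrite divr_gt0// exprn_gt0.
have [del del0 hdel] := gap_lower_bound _ _ _ _ _ (U_open i) (U_convex i)
  (f_convex i) (f_lipschitz i) (Omega_closed i) (Omega_convex i) (Omega_sub_U i)
  (f_strict i) (Oy i) (gap_ge0 i) (2 * V 0) _ e4.
have [L L0 hL] := x_lipschitz i.
have n1 : 0 < n%:R + 1 :> R by rewrite ltr_wpDl.
have L1 : 0 < L + 1 by rewrite ltr_wpDl.
(* during a time tau, y i moves by at most e / 2 *)
pose tau := e / (2 * ((n%:R + 1) * (L + 1))).
have tau0 : 0 < tau by rewrite divr_gt0// !mulr_gt0.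
exists tau, (del * tau); split => //; first exact: mulr_gt0.
move=> t t0 et; have -> : del * tau = del * ((t + tau) - t) by rewrite addrAC subrr add0r.
apply: lyapunov_drop => // [|r /andP[tr rt]]; first by rewrite lerDl ltW.
have r0 : 0 <= r by lra.
apply: (@le_trans _ _ (gap (f i) lam (ystar i) (P i r))); last first.
  by rewrite /G (bigD1 i)//= lerDl sumr_ge0// => j _; exact: gap_ge0.
apply: hdel => //; first exact: P_bounded.
have Prt : dot (P i t - P i r) (P i t - P i r) <= e ^+ 2 / 4.
  apply: le_trans (proj_nonexpansive _ (Omega_closed i) (Omega_convex i) (O0 i) _ _) _.
  apply: le_trans (ler_norm _) _; apply: le_trans (dot_le_norm _ _) _.
  rewrite -expr2 -normrN opprB.
  have hx : `|x i r - x i t| <= (L + 1) * tau.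
    by apply: le_trans (hL _ _ t0 (ltW tr)) _; nra.
  have : `|x i r - x i t| ^+ 2 <= ((L + 1) * tau) ^+ 2.
    by rewrite lerXn2r ?nnegrE ?normr_ge0// ltW// mulr_gt0.
  have -> : e ^+ 2 / 4 = (n%:R + 1) ^+ 2 * ((L + 1) * tau) ^+ 2.
    by rewrite /tau; field; rewrite !gt_eqF.
  have nn : 0 <= n%:R :> R by [].
  by have := sqr_ge0 (`|x i r - x i t|); set q := `|_| ^+ 2; set q' := _ ^+ 2; nra.
(* |u + v|^2 <= 2 |u|^2 + 2 |v|^2 spares the triangle inequality of [enorm] *)
move: et; rewrite -(subrKA (P i r)); move: (P i t - P i r) (P i r - ystar i) Prt => u v.
have := dot_ge0 (u - v); rewrite (dotBB u v) dotDl !dotDr (dotC v u).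
by move: (dot u u) (dot u v) (dot v v) => *; lra.
Qed.

Lemma trajectory_cvg i : y i t @[t --> +oo] --> ystar i.
Proof.
apply: cvg_trans (P_cvg i); apply: near_eq_cvg; near=> t.
have t0 : 0 <= t by near: t; apply: nbhs_pinfty_ge; exact: num_real.
by have [_ _ _ hy _] := sol; rewrite hy.
Unshelve. all: by end_near. Qed.

End Trajectory.

(** * Convergence of the algorithm *)

Theorem theorem3 (R : realType) (N n : nat) (hN : (2 <= N)%N)
  (f : 'I_N -> 'rV[R]_n -> R) (Omega U : 'I_N -> set 'rV[R]_n)
  (d ystar : 'I_N -> 'rV[R]_n) (a : 'M[R]_N) (k1 k2 k3 : R)
  (Omega_closed : forall i, closed (Omega i))
  (Omega_convex : forall i, convex_set (Omega i))
  (U_open : forall i, open (U i))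
  (U_convex : forall i, convex_set (U i))
  (Omega_sub_U : forall i, Omega i `<=` U i)
  (f_convex : forall i, convex_function (U i) (f i))
  (f_lipschitz : forall i, locally_lipschitz (U i) (f i))
  (f_strictly_convex : forall i, strictly_convex_on (Omega i) (f i))
  (slater_condition : slater Omega d)
  (ystar_optimal : optimal f Omega d ystar)
  (a_undirected : undirected_graph a)
  (a_connected : connected_graph a)
  (k1_gt0 : 0 < k1) (k2_gt0 : 0 < k2) (k3_gt0 : 0 < k3)
  (x s w y : 'I_N -> R -> 'rV[R]_n)
  (xswy_solution : solution k1 k2 k3 a f Omega d x s w y)
  (w_init : \sum_(i < N) w i 0 = 0) :
  forall i, y i t @[t --> +oo] --> ystar i.
Proof.
have [lam gap_ge0] := multiplier_exists f Omega U d ystar Omega_convex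
  Omega_sub_U f_convex slater_condition ystar_optimal.
have [M [lapM Mlap]] := lap_inverse a a_undirected a_connected (ltnW hN).
case: ystar_optimal => ystar_feasible _ i.
by apply: (trajectory_cvg f Omega U d ystar a M k1 k2 k3 lam) xswy_solution _ _.
Qed.
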